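(* Let $n_+,n_-\ge 1$ be integers, $n=n_++n_-$, and let $T$, $A$, $B$ be the operators in $L^2(G)$ and $\Gamma_0,\Gamma_1$ the boundary maps defined in the context. Then $B$ is selfadjoint in the Krein space $(L^2(G),[\cdot,\cdot])$, that is, $B=B^+$. For $\lambda\in\rho(A)\cap\rho(B)$ the following equality holds: $$(A-\lambda)^{-1}=(B-\lambda)^{-1}-\gamma(\lambda)M(\lambda)^{-1}\gamma(\overline\lambda)^+,$$ where $M$ is the Weyl function and $\gamma$ is the $\gamma$-field, given by $$ (\gamma(\lambda)c)_j(x)= \begin{cases} -\dfrac{c\,\sin(\mu x-\mu)}{\sin\mu} & \text{if } 1\le j\le n_+,\\[1ex] -\dfrac{c\,\sin(\mathrm i\mu x-\mathrm i\mu)}{\sin(\mathrm i\mu)} & \text{if } n_++1\le j\le n, \end{cases} $$ $$ M(\lambda)= \begin{cases} -\mu\,(n_+\cot\mu+n_-\coth\mu), & \text{if } \lambda\neq 0,\\ -n, & \text{if } \lambda=0, \end{cases} $$ for $\lambda\in\rho(A)$, $c\in\mathbb C$ and $\mu\in\mathbb C$ such that $\mu^2=\lambda$.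
   Context: $G$ is a star graph with $n=n_++n_-$ edges, each identified with $(0,1)$, all joined at the central vertex $0$. $L^2(G)=\bigoplus_{j=1}^n L^2((0,1))$ with Krein space inner product $[f,g]=\sum_{j=1}^{n_+}\int_0^1 f_j\overline{g_j}\,dt-\sum_{j=n_++1}^{n}\int_0^1 f_j\overline{g_j}\,dt$. For a densely defined operator $C$ in $L^2(G)$, $C^+$ denotes its adjoint with respect to $[\cdot,\cdot]$. $\rho$ denotes the resolvent set. The operator $T$ has domain $\mathcal D(T)=\{f=(f_1,\dots,f_n): f_j\in H^2((0,1)),\ f_j(1)=0\ \text{for all } j,\ f_1(0)=\dots=f_n(0)\}$ and acts as $(Tf)_j=-f_j''$ for $1\le j\le n_+$ and $(Tf)_j=f_j''$ for $n_++1\le j\le n$. For $f\in\mathcal D(T)$, $f(0)$ denotes the common value $f_1(0)=\dots=f_n(0)$, and $\Gamma_0 f=f(0)$, $\Gamma_1 f=\sum_{j=1}^n f_j'(0)$ (maps $\mathcal D(T)\to\mathbb C$); $(\mathbb C,\Gamma_0,\Gamma_1)$ is a boundary triple for $T$. The operators $A$ and $B$ are the restrictions of $T$ to $\mathcal D(A)=\ker\Gamma_0$ and $\mathcal D(B)=\ker\Gamma_1$, respectively. The $\gamma$-field and the Weyl function associated with $(\mathbb C,\Gamma_0,\Gamma_1)$ are defined for $\lambda\in\rho(A)$ by $\gamma(\lambda)=(\Gamma_0|_{\ker(T-\lambda)})^{-1}:\mathbb C\to\ker(T-\lambda)\subset L^2(G)$ and $M(\lambda)\Gamma_0 f=\Gamma_1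 f$ for $f\in\ker(T-\lambda)$. The operator $\gamma(\overline\lambda)^+:L^2(G)\to\mathbb C$ is the adjoint of $\gamma(\overline\lambda)$ with respect to $[\cdot,\cdot]$ on $L^2(G)$ and the standard inner product on $\mathbb C$, i.e. $(\gamma(\overline\lambda)^+g)\,\overline{c}=[g,\gamma(\overline\lambda)c]$ for $g\in L^2(G)$, $c\in\mathbb C$.
   Formalization: The sign in the resolvent formula is corrected to (A-λ)^{-1}=(B-λ)^{-1}+γ(λ)M(λ)^{-1}γ(λ̄)^+, since the printed minus sign fails (e.g. n_+=n_-=1, λ=0, g=(1,0)); and at λ=0, where the printed γ is 0/0, it is read as c(1-x). *)

(* Defs.v *)
From HB Require Import structures.
From mathcomp Require Import all_boot all_order all_algebra.
From mathcomp Require Import complex.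
From mathcomp Require Import all_classical all_reals all_analysis.

Set Implicit Arguments.
Unset Strict Implicit.
Unset Printing Implicit Defensive.

Import Order.TTheory GRing.Theory Num.Theory.
Import numFieldNormedType.Exports.

Local Open Scope classical_set_scope.
Local Open Scope ring_scope.
Local Open Scope complex_scope.
Local Open Scope quotient_scope.

(* Elementary functions of a complex variable; [cexp] is e^a (cos b + i sin b)
   at a + i b. *)
Section complex_functions.
Context {R : realType}.
Implicit Types z : R[i].

Definition cexp z : R[i] :=
  (expR (complex.Re z))%:C * (cos (complex.Im z) +i* sin (complex.Im z)).

Definition csin z : R[i] := (cexp ('i%C * z) - cexp (- ('i%C * z))) / (2 * 'i%C).
Definition ccos z : R[i] := (cexp ('i%C * z) + cexp (- ('i%C * z))) / 2.
Definition csinh z : R[i] := (cexp z - cexp (- z)) / 2.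
Definition ccosh z : R[i] := (cexp z + cexp (- z)) / 2.
Definition ccot z : R[i] := ccos z / csin z.
Definition ccoth z : R[i] := ccosh z / csinh z.

End complex_functions.

(* Complex valued L^2((0,1)), as the quotient by a.e. equality of the functions
   whose real and imaginary parts, extended by zero, are in L^2(R).  Only the
   values on ]0, 1[ of a representative matter. *)
Section L2.
Context {R : realType}.
Implicit Types (f g h : R -> R[i]) (a b : R[i]).

Definition unit_itv : set R := `]0, 1[.

Definition memL2 f : Prop :=
  ((fun x => complex.Re (f x)) \_ unit_itv
     \in Lfun (@lebesgue_measure R) 2%:E) /\
  ((fun x => complex.Im (f x)) \_ unit_itv
     \in Lfun (@lebesgue_measure R) 2%:E).

Lemma Lfun_eq (u v : R -> R) : u =1 v ->
  u \in Lfun (@lebesgue_measure R) 2%:E -> v \in Lfun (@lebesgue_measure R) 2%:E.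
Proof. by move=> /funext ->. Qed.

Lemma Lfun_lin (a1 a2 : R) (u v w : R -> R) :
  u \in Lfun (@lebesgue_measure R) 2%:E -> v \in Lfun (@lebesgue_measure R) 2%:E ->
  w \in Lfun (@lebesgue_measure R) 2%:E ->
  (fun x => a1 * u x + (a2 * v x + w x)) \in Lfun (@lebesgue_measure R) 2%:E.
Proof.
have [_ H] := @Lfun_submod_closed _ _ _ (@lebesgue_measure R) 2%:E (lee1n 2).
by move=> hu hv hw; exact: (H a1 _ _ hu (H a2 _ _ hv hw)).
Qed.

Lemma memL2_lin a f g : memL2 f -> memL2 g -> memL2 (fun x => a * f x + g x).
Proof.
move=> [f1 f2] [g1 g2]; split.
- have := Lfun_lin (complex.Re a) (- complex.Im a) f1 f2 g1.
  apply: Lfun_eq => x; rewrite /patch.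
  case: ifPn => _; last by rewrite !mulr0 !addr0.
  by case: a (f x) (g x) => [a1 a2] [? ?] [? ?] /=; rewrite addrA mulNr.
- have := Lfun_lin (complex.Re a) (complex.Im a) f2 f1 g2.
  apply: Lfun_eq => x; rewrite /patch.
  case: ifPn => _; last by rewrite !mulr0 !addr0.
  by case: a (f x) (g x) => [a1 a2] [? ?] [? ?] /=; rewrite addrA.
Qed.

Lemma memL2_0 : memL2 (fun=> 0).
Proof.
have [H _] := @Lfun_submod_closed _ _ _ (@lebesgue_measure R) 2%:E (lee1n 2).
by split; apply: Lfun_eq H => x; rewrite /patch; case: ifP.
Qed.

Lemma memL2Z a f : memL2 f -> memL2 (fun x => a * f x).
Proof.
move=> /(memL2_lin a)/(_ memL2_0); congr memL2.
by apply/funext => x; rewrite addr0.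
Qed.

Lemma memL2D f g : memL2 f -> memL2 g -> memL2 (fun x => f x + g x).
Proof.
move=> hf hg; have := memL2_lin 1 hf hg; congr memL2.
by apply/funext => x; rewrite mul1r.
Qed.

Record L2fun := MkL2fun { L2fun_val :> R -> R[i]; L2funP : `[< memL2 L2fun_val >] }.

HB.instance Definition _ := [isSub for L2fun_val].
HB.instance Definition _ := gen_eqMixin L2fun.
HB.instance Definition _ := gen_choiceMixin L2fun.

Definition L2fun_of f (hf : memL2 f) : L2fun := MkL2fun (asboolT hf).

Lemma memL2_val (u : L2fun) : memL2 u.
Proof. exact: (asboolW (L2funP u)). Qed.

Definition L2eq (u v : L2fun) : bool :=
  `[< (u : R -> R[i]) = v %[ae @lebesgue_measure R in unit_itv] >].

Let L2eq_refl : reflexive L2eq.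
Proof. by move=> u; exact/asboolP/ae_eq_refl. Qed.

Let L2eq_sym : symmetric L2eq.
Proof. by move=> u v; apply/idP/idP => /asboolP h; exact/asboolP/ae_eq_sym. Qed.

Let L2eq_trans : transitive L2eq.
Proof.
by move=> v u w /asboolP uv /asboolP vw; exact/asboolP/(ae_eq_trans uv vw).
Qed.

Canonical L2eq_equiv := EquivRel L2eq L2eq_refl L2eq_sym L2eq_trans.
End L2.
Arguments L2fun : clear implicits.

Definition L2 (R : realType) : Type := {eq_quot (@L2eq R)}.
HB.instance Definition _ (R : realType) := Choice.on (L2 R).
HB.instance Definition _ (R : realType) := EqQuotient.on (L2 R).

Definition L2rep (R : realType) (u : L2 R) : R -> R[i] := repr u.
Coercion L2rep : L2 >-> Funclass.

Lemma ae_and4 d (T : measurableType d) (R : realType)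
    (mu : {measure set T -> \bar R}) (P Q S U V : T -> Prop) :
  (forall x, P x -> Q x -> S x -> U x -> V x) ->
  {ae mu, forall x, P x} -> {ae mu, forall x, Q x} ->
  {ae mu, forall x, S x} -> {ae mu, forall x, U x} -> {ae mu, forall x, V x}.
Proof.
move=> H hP hQ hS hU; near=> x; apply: H.
- exact: (near hP x).
- exact: (near hQ x).
- exact: (near hS x).
- exact: (near hU x).
Unshelve. all: by end_near. Qed.

Section L2_lmodule.
Context {R : realType}.
Implicit Types (u v w : L2 R) (a b : R[i]).

Local Notation "f =ae g" := (f = g %[ae @lebesgue_measure R in unit_itv])
  (at level 70).

Definition L2class (f : R -> R[i]) (hf : memL2 f) : L2 R :=
  \pi_(L2 R)%qT (L2fun_of hf).

Lemma L2classE f (hf : memL2 f) : (L2class hf : R -> R[i]) =ae f.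
Proof.
have /eqmodP/asboolP : repr (L2class hf) = L2fun_of hf %[mod L2 R].
  by rewrite reprK.
exact.
Qed.

Lemma L2_eqP u v : (u : R -> R[i]) =ae v -> u = v.
Proof.
move=> uv; rewrite -[u]reprK -[v]reprK.
by apply/eqmodP/asboolP.
Qed.

Lemma L2_mem u : memL2 u.
Proof. exact: memL2_val. Qed.

Definition L2zero : L2 R := L2class memL2_0.
Definition L2add u v : L2 R := L2class (memL2D (L2_mem u) (L2_mem v)).
Definition L2scale a u : L2 R := L2class (memL2Z a (L2_mem u)).
Definition L2opp u : L2 R := L2scale (- 1) u.

Let zeroE : (L2zero : R -> R[i]) =ae (fun=> 0).
Proof. exact: L2classE. Qed.
Let addE u v : (L2add u v : R -> R[i]) =ae (fun x => u x + v x).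
Proof. exact: L2classE. Qed.
Let scaleE a u : (L2scale a u : R -> R[i]) =ae (fun x => a * u x).
Proof. exact: L2classE. Qed.

Let L2addA : associative L2add.
Proof.
move=> u v w; apply: L2_eqP.
have := addE u (L2add v w); have := addE v w.
have := addE (L2add u v) w; have := addE u v.
by apply: ae_and4 => x h1 h2 h3 h4 xI; rewrite h4// h3// h2// h1// addrA.
Qed.

Let L2addC : commutative L2add.
Proof.
move=> u v; apply: L2_eqP.
have := addE u v; have := addE v u.
by move=> H1 H2; apply: (ae_and4 _ H1 H2 H1 H1) => x h1 h2 _ _ xI; rewrite h2// h1// addrC.
Qed.

Let L2add0 : left_id L2zero L2add.
Proof.
move=> u; apply: L2_eqP.
have := addE L2zero u; have := zeroE.
by move=> H1 H2; apply: (ae_and4 _ H1 H2 H1 H1) => x h1 h2 _ _ xI; rewrite h2// h1// add0r.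
Qed.

Let L2addN : left_inverse L2zero L2opp L2add.
Proof.
move=> u; apply: L2_eqP.
have := addE (L2opp u) u; have := scaleE (- 1) u; have := zeroE.
by move=> H1 H2 H3; apply: (ae_and4 _ H1 H2 H3 H1) => x h1 h2 h3 _ xI; rewrite h3// h2// h1// mulN1r addNr.
Qed.

HB.instance Definition _ :=
  GRing.isZmodule.Build (L2 R) L2addA L2addC L2add0 L2addN.

Let L2scaleA a b u : L2scale a (L2scale b u) = L2scale (a * b) u.
Proof.
apply: L2_eqP; have := scaleE a (L2scale b u); have := scaleE b u.
have := scaleE (a * b) u.
by move=> H1 H2 H3; apply: (ae_and4 _ H1 H2 H3 H1) => x h1 h2 h3 _ xI; rewrite h3// h2// h1// mulrA.
Qed.

Let L2scale1 : left_id 1 L2scale.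
Proof.
move=> u; apply: L2_eqP; have := scaleE 1 u.
by move=> H1; apply: (ae_and4 _ H1 H1 H1 H1) => x h1 _ _ _ xI; rewrite h1// mul1r.
Qed.

Let L2scaleDr : right_distributive L2scale +%R.
Proof.
move=> a u v; apply: L2_eqP.
have := scaleE a (L2add u v); have := addE u v.
have := addE (L2scale a u) (L2scale a v).
have : (fun x => a * u x + a * v x) =ae
    (fun x => L2scale a u x + L2scale a v x).
  have H1 := scaleE a u; have H2 := scaleE a v.
  by apply: (ae_and4 _ H1 H2 H1 H1) => x h1 h2 _ _ xI; rewrite h1// h2.
apply: ae_and4 => x h1 h2 h3 h4 xI.
by rewrite h4// h3// mulrDr h1// h2.
Qed.

Let L2scaleDl u : {morph L2scale^~ u : a b / a + b}.
Proof.
move=> a b; apply: L2_eqP.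
have := scaleE (a + b) u; have := addE (L2scale a u) (L2scale b u).
have := scaleE a u; have := scaleE b u.
apply: ae_and4 => x h1 h2 h3 h4 xI.
by rewrite h4// h3// h2// h1// mulrDl.
Qed.

HB.instance Definition _ := GRing.Zmodule_isLmodule.Build R[i] (L2 R)
  L2scaleA L2scale1 L2scaleDr L2scaleDl.

Lemma L2_zeroE : ((0 : L2 R) : R -> R[i]) =ae (fun=> 0).
Proof. exact: zeroE. Qed.
Lemma L2_addE u v : ((u + v : L2 R) : R -> R[i]) =ae (fun x => u x + v x).
Proof. exact: addE. Qed.
Lemma L2_scaleE a u : ((a *: u : L2 R) : R -> R[i]) =ae (fun x => a * u x).
Proof. exact: scaleE. Qed.

End L2_lmodule.

Section operators.
Context {K : pzRingType} {V : lmodType K}.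

(* A possibly unbounded operator: only the values on [opdom] matter. *)
Record operator := Operator { opdom : set V ; action :> V -> V }.
Implicit Types C : operator.

Definition opgraph C : set (V * V) := [set fg | opdom C fg.1 /\ fg.2 = C fg.1].

Definition restriction C (D : set V) : operator := Operator (opdom C `&` D) C.

Definition shiftop C (lam : K) : operator :=
  Operator (opdom C) (fun f => C f - lam *: f).

Definition opker C : set V := [set f | opdom C f /\ C f = 0].

(* The adjoint with respect to [form], as a linear relation; it is the graph of
   an operator when the domain of [C] is dense. *)
Definition opadjoint (form : V -> V -> K) C : set (V * V) :=
  [set gh | forall f, opdom C f -> form (C f) gh.1 = form f gh.2].

(* Forces [C] to be densely defined: otherwise [opadjoint form C] is multivalued,
   hence not a graph (for a form which is nondegenerate on a Hilbert space). *)
Definition selfadjoint (form : V -> V -> K) C : Prop :=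
  opgraph C = opadjoint form C.

(* Meaningful when [C] is injective on its domain. *)
Definition opinv C : V -> V := 'pinv_(fun=> 0) (opdom C) C.

Definition resolvent C (lam : K) : V -> V := opinv (shiftop C lam).

Definition resolvent_set {R : numDomainType} (norm : V -> R) C : set K :=
  [set lam | set_bij (opdom C) setT (shiftop C lam) /\
    exists M : R, forall g, norm (resolvent C lam g) <= M * norm g].

End operators.
Arguments operator {K} V.

Section Sobolev.
Context {R : realType}.
Implicit Types (u v : L2 R) (phi : R -> R).

Local Notation mu := (@lebesgue_measure R).

Definition cintegral (f : R -> R[i]) : R[i] :=
  (\int[mu]_(x in unit_itv) complex.Re (f x)) +i*
  (\int[mu]_(x in unit_itv) complex.Im (f x)).

Definition L2ip u v : R[i] := cintegral (fun x => u x * (v x)^*%C).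

(* C_c^oo((0,1)) *)
Definition test_function phi : Prop :=
  (forall k x, derivable (phi^`(k))%classic x 1) /\
  exists a b : R, [/\ 0 < a, b < 1 & forall x, x \notin `[a, b] -> phi x = 0].

Definition is_wderiv u v : Prop := forall phi, test_function phi ->
  cintegral (fun x => u x * (phi^`()%classic x)%:C) =
  - cintegral (fun x => v x * (phi x)%:C).

(* The weak derivative of [u], if it exists in L^2. *)
Definition wderiv u : L2 R := xget 0 [set v | is_wderiv u v].

Definition H2 : set (L2 R) :=
  [set u | exists v w, is_wderiv u v /\ is_wderiv v w].

Definition continuous_rep u (f : R -> R[i]) : Prop :=
  [/\ {within `[0, 1], continuous (fun x => complex.Re (f x))},
      {within `[0, 1], continuous (fun x => complex.Im (f x))} &
      (u : R -> R[i]) = f %[ae mu in unit_itv]].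

(* The value at x in [0, 1] of the representative of [u] which is continuous on
   [0, 1], if there is one. *)
Definition bvalue u (x : R) : R[i] :=
  xget 0 [set c | exists2 f, continuous_rep u f & f x = c].

End Sobolev.

Section star_graph.
Context {R : realType}.
Variables np nm : nat.

(* Edges are numbered from 0; those with index less than np carry the sign +. *)
Local Notation L2G := {ffun 'I_(np + nm) -> L2 R}.
Implicit Types (f g : L2G) (lam c : R[i]).

Definition krein f g : R[i] :=
  \sum_(j < np + nm | (j < np)%N) L2ip (f j) (g j) -
  \sum_(j < np + nm | (np <= j)%N) L2ip (f j) (g j).

Definition L2Gnorm f : R :=
  Num.sqrt (complex.Re (\sum_(j < np + nm) L2ip (f j) (f j))).

Definition opT : operator L2G := Operator
  [set f : L2G | [/\ forall j, H2 (f j), forall j, bvalue (f j) 1 = 0 &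
    forall j k, bvalue (f j) 0 = bvalue (f k) 0]]
  (fun f : L2G => [ffun j : 'I_(np + nm) =>
    if (j < np)%N then - wderiv (wderiv (f j)) else wderiv (wderiv (f j))]).

(* The common value f(0). *)
Definition Gamma0 f : R[i] := xget 0 [set c | forall j, bvalue (f j) 0 = c].

Definition Gamma1 f : R[i] := \sum_(j < np + nm) bvalue (wderiv (f j)) 0.

Definition opA : operator L2G := restriction opT [set f | Gamma0 f = 0].
Definition opB : operator L2G := restriction opT [set f | Gamma1 f = 0].

Definition rhoA : set R[i] := resolvent_set L2Gnorm opA.
Definition rhoB : set R[i] := resolvent_set L2Gnorm opB.

Definition gamma_field lam : R[i] -> L2G :=
  'pinv_(fun=> 0) (opker (shiftop opT lam)) Gamma0.

(* The linear map M(lam) of C into C, identified with a complex number. *)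
Definition weyl lam : R[i] :=
  xget 0 [set m | forall f, opker (shiftop opT lam) f -> m * Gamma0 f = Gamma1 f].

(* The adjoint of gamma(lam), from (L^2(G), [., .]) to C. *)
Definition gamma_adj lam g : R[i] :=
  xget 0 [set d | forall c, d * c^*%C = krein g (gamma_field lam c)].

End star_graph.

(* Main.v *)
(* Selfadjointness of B needs no density of test functions: Green's identity
   makes B symmetric, and B is onto because u'' = k can be solved explicitly on
   each edge.  If [Bf, g] = [f, h] for all f in dom B, choose g' in dom B with
   Bg' = h; then g - g' is orthogonal to the range of B, so g = g'.

   For lam in rho(A), injectivity of A - lam forces sin(nu_j) <> 0 on every edge
   (otherwise a sine supported on that edge is an eigenfunction) and makes
   Gamma0 injective on ker(T - lam), so the explicit sine solution gives gamma
   and M without a uniqueness theorem for the differential equation.  The same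
   holds at the conjugate of lam, since A is symmetric and A - lam is onto.
   Krein's formula follows from Green's identity applied to (A - lam)^-1 g and
   gamma(conj lam) c, because the difference of the two resolvents takes values
   in ker(T - lam).

   Functions with a weak derivative in L^2 are handled through primitives: by
   du Bois-Reymond's lemma u' = v weakly iff u = c + \int_0^x v almost everywhere,
   and integration by parts for such primitives is Fubini on a triangle. *)

Require Import Defs.
From mathcomp Require Import all_boot all_order all_algebra.
From mathcomp Require Import complex.
From mathcomp Require Import all_classical all_reals all_analysis.
From mathcomp Require Import measurable_realfun.
From mathcomp Require Import ring lra.

Set Implicit Arguments.
Unset Strict Implicit.
Unset Printing Implicit Defensive.

Import Order.TTheory GRing.Theory Num.Theory.
Import numFieldNormedType.Exports.

Local Open Scope classical_set_scope.
Local Open Scope ring_scope.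
Local Open Scope complex_scope.

(** * Smooth bump functions *)

Section smooth_functions.
Context {R : realType}.
Implicit Types (f g F : R -> R) (p : {poly R}) (s t x : R).

(** The classical flat function [exp(-1/t)], weighted by a polynomial in [1/t] so that the family is
    closed under differentiation. *)
Definition flat p t : R := if 0 < t then p.[t^-1] * expR (- t^-1) else 0.

(** Each monomial is bounded on its own, from [s^i <= i! * expR s], a consequence of the exponential
    series. *)
Lemma poly_le_expR p : exists C, forall s, 0 <= s -> `|p.[s]| <= C * expR s.
Proof.
exists (\sum_(i < size p) `|p`_i| * i`!%:R) => s s0.
rewrite horner_coef (le_trans (ler_norm_sum _ _ _))// mulr_suml ler_sum// => i _.
rewrite normrM -mulrA ler_wpM2l// ger0_norm ?exprn_ge0//.
case: (i : nat) => [|k]; first by rewrite expr0 mul1r -expR0 ler_expR.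
rewrite -ler_pdivrMl ?ltr0n ?fact_gt0// mulrC.
by rewrite (le_trans _ (expR_ge1Dxn k s0))// lerDr.
Qed.

(** The exponential bound is applied to [p * 'X] at [s = 1/t]: the extra factor ['X] turns into the
    factor [t] on the right. *)
Lemma flat_le p : exists C, forall t, `|flat p t| <= C * `|t|.
Proof.
have [C hC] := poly_le_expR (p * 'X).
have C0 : 0 <= C.
  by have := hC 0 (lexx _); rewrite expR0 mulr1; apply: le_trans.
exists C => t; rewrite /flat; case: ifPn => [t0|_]; last by rewrite normr0 mulr_ge0.
have := hC _ (ltW (_ : 0 < t^-1)); rewrite invr_gt0 => /(_ t0).
rewrite hornerMX normrM normfV (gtr0_norm t0) ler_pdivrMr// => h.
rewrite normrM (gtr0_norm (expR_gt0 _)) expRN ler_pdivrMr ?expR_gt0//.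
by rewrite mulrAC.
Qed.

(** For [t > 0], the product and chain rules give [(p - p')(1/t) * t^-2 * exp(-1/t)], and [t^-2] is
    absorbed as ['X^2]. *)
Lemma is_derive_flat p t : is_derive t 1 (flat p) (flat ((p - p^`()) * 'X^2) t).
Proof.
have [t0|t0|<-] := ltgtP 0 t.
- have : is_derive t 1 (fun t => p.[t^-1] * expR (- t^-1))
     (flat ((p - p^`()) * 'X^2) t).
    have tn0 : t != 0 by rewrite gt_eqF.
    have dV : is_derive t (1:R) (fun t : R => t^-1) (- t^-2).
      have := @is_deriveV _ (@id R) t 1 1 tn0 _.
      by move=> /(_ _); rewrite /GRing.scale/= mulr1; apply.
    have dP : is_derive t (1:R) (fun t : R => p.[t^-1]) (p^`().[t^-1] * - t^-2).
      exact: (@is_derive1_comp _ (horner p) (fun t : R => t^-1)).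
    have dE : is_derive t (1:R) (fun t : R => expR (- t^-1)) (expR (- t^-1) * (t^-2)).
      apply: (@is_derive1_comp _ expR (fun t : R => - t^-1)).
      by have := is_deriveN dV; rewrite opprK.
    apply: (is_derive_eq (is_deriveM dP dE)).
    rewrite /flat t0 /GRing.scale/= hornerM hornerXn hornerD hornerN -exprVn.
    ring.
  apply: near_eq_is_derive; near=> z; rewrite /flat ifT//.
  by near: z; exact: lt_nbhsr.
- have -> : flat ((p - p^`()) * 'X^2) t = 0 by rewrite /flat ltNge (ltW t0).
  apply: (@near_eq_is_derive _ _ _ (cst 0)); near=> z.
  rewrite /flat ifF//; apply/negbTE; rewrite -leNgt; apply: ltW.
  by near: z; exact: lt_nbhsl.
- have -> : flat ((p - p^`()) * 'X^2) 0 = 0 by rewrite /flat ltxx.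
  (* At 0 the difference quotient of [flat p] is [flat (p * 'X)], which is bounded by a multiple of
     [|h|]. *)
  have [C hC] := flat_le (p * 'X).
  have h0 : h^-1 *: (flat p (h *: (1 : R) + 0) - flat p 0) @[h --> 0^'] --> (0 : R).
    apply/cvgr0Pnorm_lt => e e0; near=> h.
    rewrite addr0 {2}/flat ltxx subr0 [h *: 1]mulr1.
    have hn0 : h != 0 by near: h; exact: nbhs_dnbhs_neq.
    have -> : h^-1 *: flat p h = flat (p * 'X) h.
      rewrite /flat; case: ifP => _; rewrite /GRing.scale/= ?mulr0//.
      by rewrite hornerMX mulrCA mulrA.
    rewrite (le_lt_trans (hC h))//.
    have : `|h| < e / (`|C| + 1).
      near: h; apply: dnbhs0_lt; rewrite divr_gt0// ltr_wpDl//.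
    rewrite ltr_pdivlMr ?ltr_wpDl// => /(le_lt_trans _); apply.
    by rewrite mulrC ler_wpM2l// (le_trans (ler_norm _))// lerDl.
  apply: DeriveDef; first by apply/cvg_ex; exists 0.
  by apply/cvg_lim; [exact: Rhausdorff|].
Unshelve. all: by end_near. Qed.

(* Closed under derivation by construction, which avoids a Leibniz rule for
   iterated derivatives. *)
Inductive smooth : (R -> R) -> Prop :=
| smooth_flat p s t : smooth (fun x => flat p (s * x + t))
| smoothZ c f : smooth f -> smooth (fun x => c * f x)
| smoothD f g : smooth f -> smooth g -> smooth (fun x => f x + g x)
| smoothM f g : smooth f -> smooth g -> smooth (fun x => f x * g x)
| smooth_primitive F f : (forall x, is_derive x 1 F (f x)) -> smooth f -> smooth F.

Lemma smooth_is_derive f : smooth f ->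
  exists2 g, smooth g & forall x, is_derive x 1 f (g x).
Proof.
elim=> {f} [p s t|c f _ [g sg dg]|f1 f2 sf1 [g1 sg1 dg1] sf2 [g2 sg2 dg2]|
  f1 f2 sf1 [g1 sg1 dg1] sf2 [g2 sg2 dg2]|F f dF sf _].
- exists (fun x => s * flat ((p - p^`()) * 'X^2) (s * x + t)).
    by apply: smoothZ; exact: smooth_flat.
  move=> x; rewrite mulrC.
  apply: (@is_derive1_comp _ (flat p) (fun x => s * x + t)).
    exact: is_derive_flat.
  apply: (is_derive_eq (_ : is_derive x (1:R) ((s *: (@id R)) + cst t) (s *: 1 + 0))).
  by rewrite addr0 /GRing.scale/= mulr1.
- exists (fun x => c * g x); first exact: smoothZ.
  by move=> x; exact: (is_deriveZ c (dg x)).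
- exists (fun x => g1 x + g2 x); first exact: smoothD.
  by move=> x; exact: (is_deriveD (dg1 x) (dg2 x)).
- exists (fun x => f1 x * g2 x + f2 x * g1 x).
    by apply: smoothD; apply: smoothM.
  by move=> x; exact: (is_deriveM (dg1 x) (dg2 x)).
- by exists f.
Qed.

Lemma smooth_derive1 f : smooth f -> smooth (f^`()%classic).
Proof.
move=> /smooth_is_derive[g sg dg]; suff -> : f^`()%classic = g by [].
by apply/funext => x; rewrite derive1E; exact: (@derive_val _ _ _ _ _ _ _ (dg x)).
Qed.

Lemma smooth_derivable f x : smooth f -> derivable f x 1.
Proof. by move=> /smooth_is_derive[g _ /(_ x)[]]. Qed.

Lemma smooth_continuous f : smooth f -> continuous f.
Proof.
move=> sf x; apply/differentiable_continuous/derivable1_diffP.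
exact: smooth_derivable.
Qed.

Lemma smooth_derive1n f k : smooth f -> smooth (f^`(k))%classic.
Proof. by move=> sf; elim: k => // k ih; exact: smooth_derive1. Qed.

Lemma smooth_test_function f (a b : R) : smooth f -> 0 < a -> b < 1 ->
  (forall x, x \notin `[a, b] -> f x = 0) -> test_function f.
Proof.
move=> sf a0 b1 f0; split; last by exists a, b; split.
by move=> k x; apply: smooth_derivable; exact: smooth_derive1n.
Qed.

(** A smooth approximation of the indicator of []a, b[]: one factor vanishes on each side, and
    inside the interval both tend to 1 as [n] grows. *)
Definition bumpf (a b : R) (n : nat) x : R :=
  flat 1 (n%:R * x - n%:R * a) * flat 1 (- n%:R * x + n%:R * b).

Lemma smooth_bump a b n : smooth (bumpf a b n).
Proof. by apply: smoothM; exact: smooth_flat. Qed.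

Lemma bump_out a b n x : x \notin `]a, b[ -> bumpf a b n x = 0.
Proof.
rewrite in_itv/= negb_and -!leNgt => /orP[xa|bx]; rewrite /bumpf /flat.
  by rewrite ifF ?mul0r// -mulrBr; apply/negbTE; rewrite -leNgt mulr_ge0_le0// subr_le0.
rewrite [X in _ * X]ifF ?mulr0//; apply/negbTE; rewrite -leNgt.
by rewrite mulNr addrC -mulrBr mulr_ge0_le0// subr_le0.
Qed.

Lemma flat1_itv t : 0 <= flat 1 t <= 1.
Proof.
rewrite /flat; case: ifP => [t0|_]; last by rewrite lexx ler01.
rewrite hornerC mul1r expR_ge0/= -[leRHS]expR0 ler_expR oppr_le0 invr_ge0.
exact: ltW.
Qed.

Lemma bump_itv a b n x : 0 <= bumpf a b n x <= 1.
Proof.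
rewrite /bumpf; set u := flat _ _; set v := flat _ _.
have /andP[u0 u1] : 0 <= u <= 1 by exact: flat1_itv.
have /andP[v0 v1] : 0 <= v <= 1 by exact: flat1_itv.
by rewrite mulr_ge0//= mulr_ile1.
Qed.

Lemma flat1_cvg t : 0 < t -> flat 1 (n%:R * t) @[n --> \oo] --> (1 : R).
Proof.
move=> t0; have : expR (- (n%:R^-1 * t^-1)) @[n --> \oo] --> (1 : R).
  rewrite [X in _ --> X](_ : 1 = expR (- (0 * t^-1))); last first.
    by rewrite mul0r oppr0 expR0.
  apply: continuous_cvg; first exact: continuous_expR.
  apply: cvgN; apply: cvgMl.
  apply/gtr0_cvgV0; last exact: cvgr_idn.
  by near=> n; rewrite ltr0n; near: n; exists 1%N.
apply: cvg_trans; apply: near_eq_cvg; near=> n.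
have n0 : (0 < n)%N by near: n; exists 1%N.
by rewrite /flat mulr_gt0 ?ltr0n// hornerC mul1r invfM.
Unshelve. all: by end_near. Qed.

Lemma bump_cvg a b x : bumpf a b n x @[n --> \oo] --> (\1_(`]a, b[ : set R) x : R).
Proof.
rewrite indicE mem_setE; have [xab|xab] := boolP (x \in `]a, b[); last first.
  by apply: cvg_near_cst; apply: nearW => n; rewrite bump_out.
move: xab; rewrite in_itv/= => /andP[ax xb].
rewrite [X in _ --> X](_ : _ = 1 * 1 :> R); last by rewrite mulr1.
apply: cvgM.
  have := flat1_cvg (_ : 0 < x - a); rewrite subr_gt0 => /(_ ax).
  by under eq_fun do rewrite mulrBr.
have := flat1_cvg (_ : 0 < b - x); rewrite subr_gt0 => /(_ xb).
by under eq_fun do rewrite mulrBr addrC -mulNr.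
Qed.

End smooth_functions.

(** * Primitives of integrable functions on the unit interval *)

Section primitives.
Context {R : realType}.
Implicit Types (f g u v phi : R -> R) (a b c x : R).
Local Notation mu := (@lebesgue_measure R).
Local Notation I := (@unit_itv R).
Local Notation intI f := (mu.-integrable I (EFin \o f)).

Lemma measurable_unit_itv : measurable (I : set (measurableTypeR R)).
Proof. exact: measurable_itv. Qed.
Hint Resolve measurable_unit_itv : core.

Lemma mu_unit_itv : mu I = 1%E.
Proof. by rewrite lebesgue_measure_itv/= lte_fin ltr01 oppr0 adde0. Qed.

Lemma intI_cc f : intI f -> mu.-integrable `[0, 1] (EFin \o f).
Proof.
move=> /integrableP[mf If]; have mf' := emeasurable_fun_itv_cc mf.
apply/integrableP; split => //.
rewrite integral_itv_bndoo//; apply: measurableT_comp => //.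
Qed.

Lemma intI_ext f g : {in I, f =1 g} -> intI f -> intI g.
Proof. by move=> fg; apply: eq_integrable => // x xI /=; rewrite fg. Qed.

Lemma intI_lin a f g : intI f -> intI g -> intI (fun x => a * f x + g x).
Proof.
move=> hf hg; rewrite (_ : EFin \o _ = (fun x => (a%:E * (EFin \o f) x)%E) \+ (EFin \o g))%E//.
by apply: integrableD => //; exact: integrableZl.
Qed.

Lemma intI_cst a : intI (fun=> a).
Proof.
apply: measurable_bounded_integrable => //.
  by apply: (le_lt_trans _ (ltry 1)); rewrite -mu_unit_itv.
exists `|a|; split; first exact: num_real.
by move=> M /ltW aM x _ /=; rewrite (le_trans _ aM).
Qed.

Lemma itv01W x : x \in `]0, 1[ -> x \in (`[0, 1] : interval R).
Proof. by rewrite !in_itv/= => /andP[/ltW -> /ltW ->]. Qed.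

Lemma within_bounded_measurable g : {within `[0, 1], continuous g} ->
  measurable_fun I g /\ [bounded g x | x in I].
Proof.
move=> cg; split.
  have := subspace_continuous_measurable_fun (measurable_itv `[0, 1]) cg.
  by apply: measurable_funS => // x; exact: itv01W.
have /compact_bounded[M [Mr hM]] : compact (g @` `[0, 1]).
  by apply: continuous_compact => //; exact: segment_compact.
exists M; split => // N /hM h x /itv01W xI.
by apply: h; exists x.
Qed.

Lemma intIM f g : intI f -> {within `[0, 1], continuous g} ->
  intI (fun x => f x * g x).
Proof.
move=> hf /within_bounded_measurable[mg bg].
by have := integrableMl measurable_unit_itv hf mg bg.
Qed.

Lemma eq_intI f g : {in `]0, 1[, f =1 g} ->
  \int[mu]_(x in I) f x = \int[mu]_(x in I) g x.
Proof. by move=> fg; apply: eq_Rintegral => x; rewrite inE; exact: fg. Qed.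

Lemma ae_eq_intI f g : intI f -> intI g -> f = g %[ae mu in I] ->
  \int[mu]_(x in I) f x = \int[mu]_(x in I) g x.
Proof.
move=> /(measurable_int mu) mf /(measurable_int mu) mg fg.
rewrite /Rintegral; congr fine; apply: ae_eq_integral => //.
apply: filterS fg; first exact: (ae_filter_ringOfSetsType mu).
by move=> x h xI /=; rewrite h.
Qed.

Lemma int_lin a f g : intI f -> intI g ->
  \int[mu]_(x in I) (a * f x + g x) =
  a * (\int[mu]_(x in I) f x) + \int[mu]_(x in I) g x.
Proof.
move=> hf hg; rewrite RintegralD//; last first.
  by rewrite (_ : EFin \o _ = (fun x => (a%:E * (EFin \o f) x)%E))//; exact: integrableZl.
by rewrite RintegralZl.
Qed.

Definition prim f x : R := \int[mu]_(t in `[0, x]) f t.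

Lemma intIS f x : intI f -> x <= 1 -> mu.-integrable `[0, x] (EFin \o f).
Proof.
move=> /intI_cc hf x1; apply: integrableS hf => // y /=; rewrite !in_itv/=.
by move=> /andP[-> /le_trans ->].
Qed.

Lemma prim_continuous f : intI f -> {within `[0, 1], continuous (prim f)}.
Proof. by move=> /intI_cc hf; exact: parameterized_integral_continuous. Qed.

Lemma prim0 f : prim f 0 = 0.
Proof. by rewrite /prim set_itv1 Rintegral_set1. Qed.

Lemma prim1 f : intI f -> prim f 1 = \int[mu]_(x in I) f x.
Proof.
move=> hf; rewrite /prim /Rintegral integral_itv_bndoo//.
exact: (measurable_int mu hf).
Qed.

Lemma ae_eq_prim f g x : intI f -> intI g -> f = g %[ae mu in I] -> x <= 1 ->
  prim f x = prim g x.
Proof.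
move=> hf hg fg x1; rewrite /prim /Rintegral; congr fine.
have mS h : intI h -> measurable_fun (`]0, x[ : set R) (fun t => (h t)%:E).
  move=> /intIS/(_ x1)/(measurable_int mu); apply: measurable_funS => //.
  exact: subset_itv_oo_cc.
have E h : intI h -> (\int[mu]_(t in `[0%R, x]) (h t)%:E =
    \int[mu]_(t in `]0%R, x[) (h t)%:E)%E.
  by move=> /mS; exact: integral_itv_bndoo.
have xI : `]0, x[ `<=` I.
  by move=> y; rewrite /unit_itv/= !in_itv/= => /andP[-> /lt_le_trans ->].
rewrite (E _ hf) (E _ hg); apply: ae_eq_integral => //.
- exact: mS.
- exact: mS.
apply: filterS fg; first exact: (ae_filter_ringOfSetsType mu).
by move=> y h yx /=; rewrite h//; exact: xI.
Qed.

Lemma prim_derive phi psi x : (forall x, is_derive x 1 phi (psi x)) ->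
  continuous psi -> 0 <= x -> phi x = phi 0 + prim psi x.
Proof.
move=> dphi cpsi; rewrite le_eqVlt => /predU1P[<-|x0].
  by rewrite prim0 addr0.
have cphi : continuous phi.
  by move=> y; apply/differentiable_continuous/derivable1_diffP; case: (dphi y).
have := @continuous_FTC2 R psi phi 0 x x0 (continuous_subspaceT cpsi).
rewrite /prim /Rintegral => ->.
- by rewrite -EFinD/= addrC subrK.
- split; first by move=> y _; case: (dphi y).
    exact/cvg_at_right_filter/cphi.
  exact/cvg_at_left_filter/cphi.
- by move=> y _; rewrite derive1E; exact: (@derive_val _ _ _ _ _ _ _ (dphi y)).
Qed.

End primitives.

(** * Integration by parts for primitives of integrable functions *)

Section integration_by_parts.
Context {R : realType}.
Implicit Types (f g u v : R -> R) (c x : R).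
Local Notation mu := (@lebesgue_measure R).
Local Notation I := (@unit_itv R).
Local Notation intI f := (mu.-integrable I (EFin \o f)).
Local Notation intT f := (mu.-integrable setT (EFin \o f)).

#[local] Hint Resolve measurable_unit_itv : core.

Lemma EFin_Rintegral u : intT u -> (\int[mu]_x (u x)%:E = (\int[mu]_x u x)%R%:E)%E.
Proof. by move=> hu; rewrite /Rintegral fineK//; exact: integrable_fin_num. Qed.

Lemma EFin_RintegralZ c u (A : set R) : measurable (A : set (measurableTypeR R)) ->
  intT u ->
  (\int[mu]_x (c * (u \_ A) x)%:E = (c * \int[mu]_(x in A) u x)%R%:E)%E.
Proof.
move=> mA hu; have hA : intT (u \_ A).
  rewrite (_ : EFin \o _ = (EFin \o u) \_ A); last by rewrite restrict_EFin.
  by apply/integrable_restrict => //; rewrite setTI; exact: integrableS hu.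
rewrite Rintegral_mkcond -RintegralZl//; apply: EFin_Rintegral.
rewrite (_ : EFin \o _ = (fun x => (c%:E * (EFin \o (u \_ A)) x)%E))//.
exact: integrableZl.
Qed.

(** Both sides are iterated integrals of [u x * v y] over the half-plane [y <= x], so this is Fubini
    for the kernel [k]. *)
Lemma Rintegral_triangle u v : intT u -> intT v ->
  \int[mu]_x (u x * \int[mu]_(y in `]-oo, x]) v y) =
  \int[mu]_y (v y * \int[mu]_(x in `[y, +oo[) u x).
Proof.
move=> hu hv.
have mu_ : measurable_fun setT u by apply/measurable_EFinP; exact: measurable_int hu.
have mv_ : measurable_fun setT v by apply/measurable_EFinP; exact: measurable_int hv.
pose k (z : measurableTypeR R * measurableTypeR R) : R :=
  if z.2 <= z.1 then u z.1 * v z.2 else 0.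
have mu1 : measurable_fun setT (u \o fst : measurableTypeR R * measurableTypeR R -> R).
  by apply: measurableT_comp => //; exact: measurable_fst.
have mv2 : measurable_fun setT (v \o snd : measurableTypeR R * measurableTypeR R -> R).
  by apply: measurableT_comp => //; exact: measurable_snd.
have mk : measurable_fun setT k.
  apply: measurable_fun_ifT => //; last exact: measurable_funM.
  apply: measurable_fun_ler; [exact: measurable_snd|exact: measurable_fst].
(* The untruncated product is integrable because its absolute value splits; it dominates [k], which
   makes Fubini applicable. *)
have ik0 : (mu \x mu)%E.-integrable setT (EFin \o ((u \o fst) \* (v \o snd))).
  apply/integrable12ltyP => /=.
    by apply/measurable_EFinP; exact: measurable_funM.
  have hc x : (\int[mu]_y `|(u x * v y)%:E| = `|u x|%:E * \int[mu]_y `|(v y)%:E|)%E.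
    under eq_integral do rewrite EFinM abseM.
    rewrite ge0_integralZl//; do 2 apply: measurableT_comp => //.
  under eq_integral do rewrite hc.
  have /integrableP[_ hu2] := hu; have /integrableP[_ hv2] := hv.
  rewrite ge0_integralZr//.
  + apply: lte_mul_pinfty => //; first exact: integral_ge0.
    by rewrite ge0_fin_numE//; exact: integral_ge0.
  + by do 2 apply: measurableT_comp => //.
  + exact: integral_ge0.
have ik : (mu \x mu)%E.-integrable setT (EFin \o k).
  apply: le_integrable ik0 => //; first exact/measurable_EFinP.
  move=> z _ /=; rewrite lee_fin /k; case: ifP => _ //.
  by rewrite normr0.
have k1 x : (\int[mu]_y (k (x, y))%:E = (u x * \int[mu]_(y in `]-oo, x]) v y)%R%:E)%E.
  rewrite -EFin_RintegralZ//.
  apply: eq_integral => y _; rewrite /k /= patchE mem_setE in_itv/=.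
  by case: ifP => // _; rewrite mulr0.
have k2 y : (\int[mu]_x (k (x, y))%:E = (v y * \int[mu]_(x in `[y, +oo[) u x)%R%:E)%E.
  rewrite -EFin_RintegralZ//.
  apply: eq_integral => x _; rewrite /k /= patchE mem_setE in_itv/= andbT.
  by case: ifP => _; rewrite ?mulr0// mulrC.
rewrite /Rintegral; congr fine.
transitivity (\int[mu]_x \int[mu]_y (k (x, y))%:E)%E.
  by apply: eq_integral => x _; rewrite k1.
transitivity (\int[mu]_y \int[mu]_x (k (x, y))%:E)%E; first exact: (Fubini ik).
by apply: eq_integral => x _; rewrite k2.
Qed.

(** [Rintegral_triangle] is applied to [f] and [g] extended by zero. One inner integral is
    [prim g x], the other is [prim f 1 - prim f y]. *)
Lemma int_prim_mul f g : intI f -> intI g ->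
  \int[mu]_(x in I) (f x * prim g x) + \int[mu]_(x in I) (prim f x * g x) =
  prim f 1 * prim g 1.
Proof.
move=> hf hg.
have hT h : intI h -> intT (h \_ I).
  move=> hh; rewrite (_ : EFin \o _ = (EFin \o h) \_ I); last by rewrite restrict_EFin.
  exact/(integrable_mkcond _ measurable_unit_itv).
have := Rintegral_triangle (hT _ hf) (hT _ hg).
have -> : \int[mu]_x ((f \_ I) x * \int[mu]_(y in `]-oo, x]) (g \_ I) y) =
    \int[mu]_(x in I) (f x * prim g x).
  rewrite [RHS]Rintegral_mkcond; apply: eq_Rintegral => x _.
  rewrite !patchE mem_setE; case: ifPn => [xI|_]; last by rewrite mul0r.
  congr (_ * _); rewrite -Rintegral_mkcondr /prim -Rintegral_itv_obnd_cbnd; last first.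
    apply: (integrableS measurable_unit_itv _ _ hg) => // y.
    rewrite /unit_itv /= !in_itv/= => /andP[->].
    by move: xI; rewrite in_itv/= => /andP[_ x1] /le_lt_trans ->.
  congr Rintegral; apply/seteqP; split => y; rewrite /unit_itv/= !in_itv/=.
    by move=> [yx /andP[-> _]].
  move: xI; rewrite in_itv/= => /andP[_ x1] /andP[-> yx]; split => //.
  exact: le_lt_trans yx x1.
have -> : \int[mu]_y ((g \_ I) y * \int[mu]_(x in `[y, +oo[) (f \_ I) x) =
    \int[mu]_(y in I) ((- 1) * (prim f y * g y) + prim f 1 * g y).
  rewrite [RHS]Rintegral_mkcond; apply: eq_Rintegral => y _.
  rewrite !patchE mem_setE; case: ifPn => [yI|_]; last by rewrite mul0r.
  rewrite -Rintegral_mkcondr.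
  have -> : [set` `[y, +oo[] `&` I = [set` `[y, 1[].
    apply/seteqP; split => x; rewrite /unit_itv/= !in_itv/= ?andbT.
      by move=> [-> /andP[_ ->]].
    move: yI; rewrite in_itv/= => /andP[y0 _] /andP[yx ->]; split => //.
    by rewrite (lt_le_trans y0 yx).
  have y01 : 0 <= y <= 1 by move: yI; rewrite in_itv/= => /andP[/ltW-> /ltW->].
  have := @Rintegral_itvB _ f (BLeft 0) (BRight 1) y (intI_cc hf).
  rewrite !bnd_simp => /(_ (proj1 (andP y01)) (proj2 (andP y01))) E.
  have h2 : mu.-integrable `[y, 1[ (EFin \o f).
    apply: (integrableS measurable_unit_itv _ _ hf) => // x.
    rewrite /unit_itv/= !in_itv/= => /andP[yx ->].
    by move: yI; rewrite in_itv/= => /andP[/lt_le_trans -> //].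
  have h1 : mu.-integrable `]y, 1[ (EFin \o f).
    by apply: integrableS h2 => // x /=; rewrite !in_itv/= => /andP[/ltW -> ->].
  rewrite -Rintegral_itv_obnd_cbnd// Rintegral_itv_bndo_bndc// -E.
  by rewrite -/(prim f y) -/(prim f 1); ring.
have hfg : intI (fun x => prim f x * g x).
  apply: (@intI_ext _ (fun x => g x * prim f x)); first by move=> x _; rewrite mulrC.
  by apply: intIM => //; exact: prim_continuous.
move=> ->; rewrite int_lin//; last first.
  apply: (@intI_ext _ (fun x => prim f 1 * g x + 0)); first by move=> x _; rewrite addr0.
  by apply: intI_lin => //; exact: intI_cst.
by rewrite RintegralZl// -(prim1 hg); ring.
Qed.

(** The constants of integration contribute only terms linear in [f] or [g], so [int_prim_mul]
    suffices. *)
Lemma int_by_parts f g a b : intI f -> intI g ->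
  \int[mu]_(x in I) (f x * (b + prim g x) + (a + prim f x) * g x) =
  (a + prim f 1) * (b + prim g 1) - a * b.
Proof.
move=> hf hg.
have hfg : intI (fun x => f x * prim g x) by apply: intIM => //; exact: prim_continuous.
have hgf : intI (fun x => prim f x * g x).
  apply: (@intI_ext _ (fun x => g x * prim f x)); first by move=> x _; rewrite mulrC.
  by apply: intIM => //; exact: prim_continuous.
transitivity (\int[mu]_(x in I) (b * f x + (a * g x + (1 * (f x * prim g x) + prim f x * g x)))).
  by apply: eq_intI => x _; ring.
rewrite !int_lin//; do ?[exact: intI_lin].
  by rewrite mul1r int_prim_mul// -!prim1//; ring.
by do ?[apply: intI_lin => //].
Qed.

End integration_by_parts.

(** * The lemma of du Bois-Reymond *)

Section du_bois_reymond.
Context {R : realType}.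
Implicit Types (f g u v w phi : R -> R) (a b c x : R).
Local Notation mu := (@lebesgue_measure R).
Local Notation I := (@unit_itv R).
Local Notation intI f := (mu.-integrable I (EFin \o f)).
#[local] Hint Resolve measurable_unit_itv : core.

(** Dominated convergence with bound [|v|], since bumps take values in [[0, 1]]. *)
Lemma int_bump_cvg v a b : intI v -> 0 <= a -> b <= 1 ->
  \int[mu]_(x in I) (v x * bumpf a b n x) @[n --> \oo] -->
  \int[mu]_(x in `]a, b[) v x.
Proof.
move=> hv a0 b1.
have sub : `]a, b[ `<=` I.
  move=> x; rewrite /unit_itv/= !in_itv/= => /andP[ax xb].
  by rewrite (le_lt_trans a0 ax) (lt_le_trans xb b1).
have cb n : {within `[0, 1], continuous (bumpf a b n)}.
  by apply: continuous_subspaceT; apply: smooth_continuous; exact: smooth_bump.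
have hvn n : intI (fun x => v x * bumpf a b n x) by exact: intIM.
have hab : mu.-integrable I (EFin \o (v \_ `]a, b[)).
  rewrite (_ : EFin \o _ = (EFin \o v) \_ `]a, b[); last by rewrite restrict_EFin.
  apply/integrable_restrict => //; rewrite setIidr//.
  exact: (integrableS measurable_unit_itv _ _ hv).
have [] := @dominated_convergence _ _ _ mu I measurable_unit_itv
  (fun n x => (v x * bumpf a b n x)%:E) (fun x => ((v \_ `]a, b[) x)%:E)
  (fun x => `|v x|%:E).
- by move=> n; exact: (measurable_int mu (hvn n)).
- exact: (measurable_int mu hab).
- apply: aeW => x _ /=; apply: cvg_EFin; first exact: nearW.
  rewrite patchE -[X in _ --> X](_ : v x * (\1_(`]a, b[ : set R) x) = _).
    by apply: cvgMr; exact: bump_cvg.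
  by rewrite indicE; case: ifP; rewrite (mulr1, mulr0).
- exact: (integrable_abse hv).
- apply: aeW => x n _ /=; rewrite lee_fin normrM ler_piMr//.
  by have /andP[? ?] := bump_itv a b n x; rewrite ger0_norm.
move=> _ _ h; rewrite -(setIidr sub) Rintegral_mkcondr.
apply: fine_cvg; rewrite /Rintegral fineK; [exact: h|exact: integrable_fin_num].
Qed.

(** In the limit [v] has integral zero over every inner interval, so its running integral is
    constant on []0, 1[]; by Lebesgue differentiation the derivative of that integral is [v] almost
    everywhere. *)
Lemma bump_ae0 v : intI v ->
  (forall a b n, 0 < a -> a < b -> b < 1 ->
    \int[mu]_(x in I) (v x * bumpf a b n x) = 0) ->
  v = (fun=> 0) %[ae mu in I].
Proof.
move=> hv h0.
have hab a b : 0 < a -> a < b -> b < 1 -> \int[mu]_(x in `]a, b[) v x = 0.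
  move=> a0 ab b1; have := int_bump_cvg hv (ltW a0) (ltW b1).
  under eq_fun do rewrite h0//.
  by move=> /(cvg_lim (@Rhausdorff R)) <-; apply: cvg_lim; [exact: Rhausdorff|exact: cvg_cst].
have hT : mu.-integrable setT (EFin \o (v \_ I)).
  rewrite (_ : EFin \o _ = (EFin \o v) \_ I); last by rewrite restrict_EFin.
  exact/(integrable_mkcond _ measurable_unit_itv).
have hl : locally_integrable [set: R] (v \_ I).
  exact: open_integrable_locally openT hT.
have hc a b : 0 < a -> a < b -> b < 1 ->
    \int[mu]_(t in `]-oo, b]) (v \_ I) t = \int[mu]_(t in `]-oo, a]) (v \_ I) t.
  move=> a0 ab b1; apply/eqP; rewrite -subr_eq0; apply/eqP.
  have hb : mu.-integrable `]-oo, b] (EFin \o (v \_ I)) by exact: integrableS hT.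
  have := @Rintegral_itvB R (v \_ I) -oo%O (BRight b) a hb.
  rewrite !bnd_simp (ltW ab) => /(_ isT isT) ->.
  rewrite -Rintegral_itv_bndo_bndc; last exact: integrableS hT.
  rewrite -(hab _ _ a0 ab b1); apply: eq_Rintegral => x; rewrite inE/= in_itv/= => /andP[ax xb].
  by rewrite patchE mem_set// /unit_itv/= in_itv/= (lt_trans a0 ax) (lt_trans xb b1).
have hy y : mu.-integrable `]-oo, y] (EFin \o (v \_ I)) by exact: integrableS hT.
have := @FTC1Ny R (v \_ I) hy hl.
apply: filterS; first exact: (ae_filter_ringOfSetsType mu).
move=> x [_ dx] xI; move: (xI); rewrite /unit_itv/= in_itv/= => /andP[x0 x1].
have <- : (v \_ I) x = v x by rewrite patchE mem_set.
rewrite -dx derive1E.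
rewrite -(near_eq_derive (f := cst (\int[mu]_(t in `]-oo, x]) (v \_ I) t))) ?derive_cst//.
near=> y => /=.
have y0 : 0 < y by near: y; exact: lt_nbhsr.
have y1 : y < 1 by near: y; exact: lt_nbhsl.
by have [xy|yx|->//] := ltgtP x y; [rewrite (hc x y)|rewrite (hc y x)].
Unshelve. all: by end_near. Qed.

Lemma test_function_is_derive phi : test_function phi ->
  forall x, is_derive x 1 phi (phi^`()%classic x).
Proof.
move=> [dphi _] x; apply: DeriveDef; first exact: (dphi 0%N).
by rewrite derive1E.
Qed.

Lemma test_function_continuous phi : test_function phi ->
  {within `[0, 1], continuous phi} /\ continuous (phi^`()%classic).
Proof.
move=> [dphi _]; split; first apply: continuous_subspaceT; move=> x.
  apply/differentiable_continuous/derivable1_diffP; exact: (dphi 0%N).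
apply/differentiable_continuous/derivable1_diffP; exact: (dphi 1%N).
Qed.

Lemma test_function_bnd phi : test_function phi -> phi 0 = 0 /\ phi 1 = 0.
Proof.
move=> [_ [a [b [a0 b1 h]]]]; rewrite !h// in_itv/= negb_and -!ltNge ?a0//.
by rewrite b1 orbT.
Qed.

Lemma intI_continuous f : {within `[0, 1], continuous f} -> intI f.
Proof.
move=> cf; apply: (@intI_ext _ (fun x => 1 * f x)); first by move=> x _; rewrite mul1r.
by apply: intIM => //; exact: intI_cst.
Qed.

(** A test function is the primitive of its derivative and vanishes at both endpoints, so
    [int_by_parts] leaves no boundary term. *)
Lemma prim_weak_derivative v c phi : intI v -> test_function phi ->
  \int[mu]_(x in I) ((c + prim v x) * phi^`()%classic x) =
  - \int[mu]_(x in I) (v x * phi x).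
Proof.
move=> hv tphi; have [cphi cdphi] := test_function_continuous tphi.
have [phi0 phi1] := test_function_bnd tphi.
have hdphi : intI phi^`()%classic.
  by apply: intI_continuous; exact: continuous_subspaceT.
have phiE x : 0 <= x -> 0 + prim (phi^`()%classic) x = phi x.
  by move=> x0; rewrite (prim_derive (test_function_is_derive tphi) cdphi x0) phi0.
have := int_by_parts c 0 hv hdphi; rewrite phiE// phi1 !mulr0 subrr => H.
apply/eqP; rewrite -addr_eq0 -H eq_sym; apply/eqP.
transitivity (\int[mu]_(x in I) (1 * (v x * phi x) + (c + prim v x) * phi^`()%classic x)).
  by apply: eq_intI => x; rewrite in_itv/= => /andP[/ltW x0 _]; rewrite phiE// mul1r.
rewrite int_lin ?mul1r 1?addrC//; first exact: intIM.
apply: (@intI_ext _ (fun x => phi^`()%classic x * (1 * prim v x + c))).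
  by move=> x _; rewrite mul1r mulrC addrC.
apply: intIM => // x; apply: cvgD; last exact: cvg_cst.
by apply: cvgMr; exact: prim_continuous.
Qed.

Lemma smooth_lin a f g : smooth f -> smooth g -> smooth (fun x => a * f x + g x).
Proof. by move=> sf sg; apply: smoothD => //; exact: smoothZ. Qed.

(** Mean zero is what makes the primitive vanish again to the right of [b], hence have compact
    support. *)
Lemma smooth_mean0_primitive f a b : 0 < a -> b < 1 -> smooth f ->
  (forall x, x \notin `[a, b] -> f x = 0) -> \int[mu]_(x in I) f x = 0 ->
  test_function (prim f) /\ (prim f)^`()%classic = f.
Proof.
move=> a0 b1 sf f0 If0.
have hf : intI f.
  by apply/intI_continuous/continuous_subspaceT; exact: smooth_continuous.
have prima x : x < a -> prim f x = 0.
  move=> xa; rewrite /prim -[RHS](mul0r (fine (mu `[0, x]))) -Rintegral_cst//.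
  apply: eq_Rintegral => y; rewrite inE/= in_itv/= => /andP[_ yx].
  by rewrite f0// in_itv/= negb_and -ltNge (le_lt_trans yx xa).
have primb x : b < x -> prim f x = 0.
  move=> bx; rewrite -If0 /prim Rintegral_mkcond [RHS]Rintegral_mkcond.
  apply: eq_Rintegral => y _; rewrite !patchE !mem_setE.
  have [|yab] := boolP (y \in `[a, b]); last by rewrite f0// !if_same.
  rewrite !in_itv/= => /andP[ay yb].
  rewrite (lt_le_trans a0 ay) (ltW (lt_le_trans a0 ay)).
  by rewrite (le_lt_trans yb b1) (ltW (le_lt_trans yb bx)).
have dprim x : is_derive x 1 (prim f) (f x).
  (* The fundamental theorem is used at an interior point of [[0, x + 1]], which requires [0 < x];
     to the left of [a] the primitive is locally zero instead. *)
  have [xa|ax] := ltP x a.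
    rewrite f0; last by rewrite in_itv/= negb_and -ltNge xa.
    apply: (@near_eq_is_derive _ _ _ (cst 0)).
    by near=> y => /=; rewrite prima//; near: y; exact: lt_nbhsl.
  have hx : mu.-integrable `[0, x + 1] (EFin \o f).
    apply: continuous_compact_integrable; first exact: segment_compact.
    by apply: continuous_subspaceT; exact: smooth_continuous.
  have [] := @continuous_FTC1_closed R f 0 x (x + 1) _ hx.
  - by rewrite ltrDl.
  - exact: lt_le_trans ax.
  - exact: smooth_continuous.
  by move=> d1 d2; apply: DeriveDef => //; rewrite -derive1E.
split; last by apply/funext => x; rewrite derive1E; exact: (@derive_val _ _ _ _ _ _ _ (dprim x)).
apply: (@smooth_test_function _ _ a b) => //; first exact: smooth_primitive dprim sf.
move=> x; rewrite in_itv/= negb_and -!ltNge => /orP[]; [exact: prima|exact: primb].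
Unshelve. all: by end_near. Qed.

(** The difference [w = u - prim v] is orthogonal to derivatives of test functions. Those include
    every mean-zero combination of two bumps, which forces [w] to be constant. *)
Lemma du_bois_reymond u v : intI u -> intI v ->
  (forall phi, test_function phi ->
    \int[mu]_(x in I) (u x * phi^`()%classic x) =
    - \int[mu]_(x in I) (v x * phi x)) ->
  exists c, u = (fun x => c + prim v x) %[ae mu in I].
Proof.
move=> hu hv weak.
have hpv : intI (prim v) by apply: intI_continuous; exact: prim_continuous.
pose w x := - 1 * prim v x + u x.
have hw : intI w by exact: intI_lin.
have cb a b n : {within `[0, 1], continuous (bumpf a b n)}.
  by apply: continuous_subspaceT; apply: smooth_continuous; exact: smooth_bump.
have hb a b n : intI (bumpf a b n) by exact: intI_continuous.
have w0 phi : test_function phi -> \int[mu]_(x in I) (w x * phi^`()%classic x) = 0.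
  move=> tphi; have [cphi cdphi] := test_function_continuous tphi.
  have cdphi' : {within `[0, 1], continuous (phi^`()%classic)}.
    exact: continuous_subspaceT.
  transitivity (\int[mu]_(x in I) (- 1 * ((0 + prim v x) * phi^`()%classic x) +
      u x * phi^`()%classic x)).
    by apply: eq_intI => x _; rewrite /w add0r; ring.
  rewrite int_lin; last 2 first.
  - by apply: intIM => //; apply: (intI_ext _ hpv) => x _; rewrite add0r.
  - exact: intIM.
  by rewrite weak// prim_weak_derivative// mulN1r opprK subrr.
(* A reference bump with nonzero mean. It exists because the integrals of these bumps tend to [1/3],
   the length of the interval. *)
have [n0 n0P] : exists n, \int[mu]_(x in I) bumpf (1/3) (2/3) n x != 0.
  apply: contrapT => /forallNP h.
  have := @int_bump_cvg (fun=> 1) (1/3) (2/3) (intI_cst 1).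
  under eq_fun do under eq_Rintegral do rewrite mul1r.
  have h0 n : \int[mu]_(x in I) bumpf (1 / 3) (2 / 3) n x = 0.
    by have /negP/negPn/eqP := h n.
  under eq_fun do rewrite h0.
  have h1 : \int[mu]_(x in `](1 / 3 : R), 2 / 3[) (1 : R) = 1 / 3.
    transitivity (1 * fine (mu `](1 / 3), (2 / 3)[)); first exact: Rintegral_cst.
    rewrite mul1r lebesgue_measure_itv/= lte_fin ifT; last by lra.
    by rewrite -EFinB/=; field.
  rewrite h1 => /(_ _ _)/(cvg_lim (@Rhausdorff R)) h2.
  have : lim (0 @[_ --> \oo]) = 1 / 3 :> R by apply: h2; lra.
  rewrite (cvg_lim (@Rhausdorff R) (cvg_cst (0 : R))).
  lra.
pose J0 := \int[mu]_(x in I) bumpf (1/3) (2/3) n0 x.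
(* The constant for which [w - c] is orthogonal to the reference bump. *)
pose c := (\int[mu]_(x in I) (w x * bumpf (1/3) (2/3) n0 x)) / J0.
have wc : (fun x => - 1 * c + w x) = (fun=> 0) %[ae mu in I].
  apply: bump_ae0; first exact: intI_lin (intI_cst _) hw.
  move=> a b n a0 ab b1.
  pose J := \int[mu]_(x in I) bumpf a b n x.
  (* The given bump corrected by the reference bump to have mean zero; its primitive is then a test
     function, supported in the hull of both supports. *)
  pose chi x := - (J / J0) * bumpf (1/3) (2/3) n0 x + bumpf a b n x.
  have schi : smooth chi by apply: smooth_lin; exact: smooth_bump.
  have a'0 : 0 < Num.min a (1/3) :> R by rewrite lt_min a0/=; lra.
  have b'1 : Num.max b (2/3) < 1 :> R by rewrite gt_max b1/=; lra.
  have [] := smooth_mean0_primitive a'0 b'1 schi.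
  - move=> x xab; rewrite /chi !bump_out ?mulr0 ?addr0//; apply: contra xab; rewrite !in_itv/=.
      by move=> /andP[/ltW ax /ltW xb]; rewrite ge_min ax le_max xb.
    by move=> /andP[/ltW ax /ltW xb]; rewrite ge_min ax le_max xb !orbT.
  - by rewrite int_lin// -/J -/J0 mulNr divfK// addNr.
  move=> /w0 + dchi; rewrite dchi.
  under eq_Rintegral do rewrite /chi mulrDr mulrCA.
  rewrite int_lin; [|exact: intIM..] => h0.
  have E : \int[mu]_(x in I) (w x * bumpf a b n x) =
      J / J0 * (\int[mu]_(x in I) (w x * bumpf (1 / 3) (2 / 3) n0 x)).
    by apply/eqP; rewrite -subr_eq0 -h0; apply/eqP; ring.
  transitivity (\int[mu]_(x in I) (- c * bumpf a b n x + w x * bumpf a b n x)).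
    by apply: eq_intI => x _; ring.
  rewrite int_lin//; last exact: intIM.
  by rewrite E -/J /c; field.
exists c; move: wc; apply: filterS; first exact: (ae_filter_ringOfSetsType mu).
by move=> x + xI => /(_ xI); rewrite /w; lra.
Qed.

(** If the two differ at [x], they differ on a relative neighbourhood of [x], which contains an open
    interval of positive length inside []0, 1[]. *)
Lemma continuous_ae_eq f g : {within `[0, 1], continuous f} ->
  {within `[0, 1], continuous g} -> f = g %[ae mu in I] -> {in `[0, 1], f =1 g}.
Proof.
move=> cf cg fg x x01; apply/eqP; rewrite -subr_eq0; apply/negPn/negP => d0.
have /(_ x) : {within `[0, 1], continuous (fun x => f x - g x)}.
  by move=> y; apply: cvgB; [exact: cf|exact: cg].
move=> /cvgr_neq0/(_ d0) hx.
have : within `[0, 1] (nbhs x) [set y | f y - g y != 0].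
  by rewrite nbhs_subspace_in; [exact: hx|exact: x01].
move=> /nbhs_ballP[e /= e0 he].
have [N [mN N0 hN]] := fg.
(* Clipping to [[0, 1]] keeps the interval nondegenerate even when [x] is an endpoint. *)
pose l := Num.max 0 (x - e); pose r := Num.min 1 (x + e).
move: x01; rewrite in_itv/= => /andP[x0 x1].
have lr : l < r by rewrite gt_max !lt_min; apply/andP; split; apply/andP; split; lra.
have sub : `]l, r[ `<=` N.
  move=> y; rewrite /= in_itv/= gt_max lt_min => /andP[/andP[y0 ye] /andP[y1 ye']].
  apply: hN => /= /(_ _) h.
  have yI : y \in `]0, 1[ by rewrite in_itv/= y0 y1.
  have := he y; rewrite /ball/= ltr_norml => /(_ _ (itv01W yI)).
  by rewrite h// subrr eqxx; move=> /(_ _)/negP; apply => //; apply/andP; split; lra.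
have : (mu `]l, r[ <= mu N)%E by apply: le_measure => //; rewrite inE.
by rewrite N0 lebesgue_measure_itv/= lte_fin lr -EFinB lee_fin; lra.
Qed.

End du_bois_reymond.

(** * Complex-valued functions and weak derivatives in L^2 *)

Section complex_L2.
Context {R : realType}.
Implicit Types (u v w : L2 R) (f g h : R -> R[i]) (p q : R -> R) (a b c : R[i]) (x : R).
Local Notation mu := (@lebesgue_measure R).
Local Notation I := (@unit_itv R).
Local Notation Re := complex.Re.
Local Notation Im := complex.Im.
Local Notation intI f := (mu.-integrable I (EFin \o f)).
Local Notation "f =ae g" := (f = g %[ae @lebesgue_measure R in unit_itv])
  (at level 70).
#[local] Hint Resolve measurable_unit_itv : core.

Definition cintI f := intI (fun x => Re (f x)) /\ intI (fun x => Im (f x)).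

Lemma ReD a b : Re (a + b) = Re a + Re b. Proof. by case: a b => [? ?] []. Qed.
Lemma ImD a b : Im (a + b) = Im a + Im b. Proof. by case: a b => [? ?] []. Qed.
Lemma ReN a : Re (- a) = - Re a. Proof. by case: a. Qed.
Lemma ImN a : Im (- a) = - Im a. Proof. by case: a. Qed.
Lemma ReM a b : Re (a * b) = Re a * Re b - Im a * Im b.
Proof. by case: a b => [? ?] []. Qed.
Lemma ImM a b : Im (a * b) = Re a * Im b + Im a * Re b.
Proof. by case: a b => [? ?] []. Qed.
Lemma ReJ a : Re (a^*%C) = Re a. Proof. by case: a. Qed.
Lemma ImJ a : Im (a^*%C) = - Im a. Proof. by case: a. Qed.

Lemma complex_ext a b : Re a = Re b -> Im a = Im b -> a = b.
Proof. by case: a b => [? ?] [? ?] /= -> ->. Qed.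

Lemma ae_transfer2 (P Q S : R -> Prop) : (forall x, P x -> Q x -> S x) ->
  {ae mu, forall x, P x} -> {ae mu, forall x, Q x} -> {ae mu, forall x, S x}.
Proof. by move=> H hP hQ; apply: (ae_and4 _ hP hQ hP hQ) => x ? ? _ _; exact: H. Qed.

Lemma ae_Re f g : f =ae g -> (fun x => Re (f x)) =ae (fun x => Re (g x)).
Proof.
by move=> fg; apply: (ae_transfer2 _ fg fg) => x h _ xI; rewrite h.
Qed.

Lemma ae_Im f g : f =ae g -> (fun x => Im (f x)) =ae (fun x => Im (g x)).
Proof.
by move=> fg; apply: (ae_transfer2 _ fg fg) => x h _ xI; rewrite h.
Qed.

Lemma ae_Re_Im f g : (fun x => Re (f x)) =ae (fun x => Re (g x)) ->
  (fun x => Im (f x)) =ae (fun x => Im (g x)) -> f =ae g.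
Proof.
by move=> h1 h2; apply: (ae_transfer2 _ h1 h2) => x e1 e2 xI; apply: complex_ext; auto.
Qed.

Lemma cintegral_lin a f g : cintI f -> cintI g ->
  cintegral (fun x => a * f x + g x) = a * cintegral f + cintegral g.
Proof.
move=> [f1 f2] [g1 g2]; rewrite /cintegral; apply: complex_ext.
  rewrite ReD ReM /=.
  transitivity (\int[mu]_(x in I) (Re a * Re (f x) + (- Im a * Im (f x) + Re (g x)))).
    by apply: eq_intI => x _; rewrite ReD ReM; ring.
  by rewrite !int_lin//; [ring|exact: intI_lin].
rewrite ImD ImM /=.
transitivity (\int[mu]_(x in I) (Re a * Im (f x) + (Im a * Re (f x) + Im (g x)))).
  by apply: eq_intI => x _; rewrite ImD ImM; ring.
by rewrite !int_lin//; [ring|exact: intI_lin].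
Qed.

Lemma cintI_lin a f g : cintI f -> cintI g -> cintI (fun x => a * f x + g x).
Proof.
move=> [f1 f2] [g1 g2]; split.
  apply: (@intI_ext _ (fun x => Re a * Re (f x) + (- Im a * Im (f x) + Re (g x)))).
    by move=> x _; rewrite ReD ReM; ring.
  by apply: intI_lin => //; exact: intI_lin.
apply: (@intI_ext _ (fun x => Re a * Im (f x) + (Im a * Re (f x) + Im (g x)))).
  by move=> x _; rewrite ImD ImM; ring.
by apply: intI_lin => //; exact: intI_lin.
Qed.

Lemma ae_eq_cintegral f g : cintI f -> cintI g -> f =ae g ->
  cintegral f = cintegral g.
Proof.
move=> [f1 f2] [g1 g2] fg; rewrite /cintegral.
by congr (_ +i* _); apply: ae_eq_intI => //; [exact: ae_Re|exact: ae_Im].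
Qed.

(** * Square-integrable functions and the inner product of [L2] *)

Local Notation sqI p := (p \_ I \in Lfun mu 2%:E).

Lemma sqI_mul p q : sqI p -> sqI q -> intI (fun x => p x * q x).
Proof.
move=> hp hq; have /Lfun1_integrable := Lfun2_mul_Lfun1 hp hq.
move=> /(integrableS measurableT measurable_unit_itv (@subsetT _ _)).
by apply: eq_integrable => // x xI /=; rewrite !patchE xI.
Qed.

(** The interval has finite measure, so a bounded measurable function and its square are both
    integrable. *)
Lemma sqI_bounded p : measurable_fun I p -> [bounded p x | x in I] -> sqI p.
Proof.
move=> mp bp.
have mp' : measurable_fun setT (p \_ I) by apply/(measurable_restrictT _ measurable_unit_itv).
have hp : intI p.
  apply: measurable_bounded_integrable => //.
  by apply: (le_lt_trans _ (ltry 1)); rewrite -mu_unit_itv.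
have hpp : intI (fun x => p x * p x).
  by have := integrableMl measurable_unit_itv hp mp bp.
rewrite inE; apply/andP; split; rewrite inE//= /finite_norm unlock poweR_lty//.
have /integrableP[_] := (integrable_mkcond _ measurable_unit_itv).1 hpp.
suff -> : (\int[mu]_x (`|(EFin \o (p \_ I)) x| `^ 2) =
  \int[mu]_x `|((EFin \o (fun x => p x * p x)%R) \_ I) x|)%E by [].
apply: eq_integral => x _; rewrite /= !patchE; case: ifP => _ /=.
  by rewrite powR_mulrn// normrM expr2.
by rewrite normr0 powR0// pnatr_eq0.
Qed.

Lemma sqI_continuous p : {within `[0, 1], continuous p} -> sqI p.
Proof. by move=> /within_bounded_measurable[]; exact: sqI_bounded. Qed.

Lemma sqI_int p : sqI p -> intI p.
Proof.
move=> hp; have h1 : sqI (fun=> 1 : R).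
  by apply: sqI_continuous => x; exact: cvg_cst.
by apply: (intI_ext _ (sqI_mul hp h1)) => x _; rewrite mulr1.
Qed.

Lemma memL2_cintI f : memL2 f -> cintI f.
Proof. by move=> [f1 f2]; split; exact: sqI_int. Qed.

Lemma memL2_mul f g : memL2 f -> memL2 g -> cintI (fun x => f x * (g x)^*%C).
Proof.
move=> [f1 f2] [g1 g2]; split.
  apply: (@intI_ext _ (fun x => 1 * (Re (f x) * Re (g x)) + Im (f x) * Im (g x))).
    by move=> x _; rewrite ReM ReJ ImJ; ring.
  by apply: intI_lin; exact: sqI_mul.
apply: (@intI_ext _ (fun x => - 1 * (Re (f x) * Im (g x)) + Im (f x) * Re (g x))).
  by move=> x _; rewrite ImM ReJ ImJ; ring.
by apply: intI_lin; exact: sqI_mul.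
Qed.

Lemma memL2_continuous f : {within `[0, 1], continuous (fun x => Re (f x))} ->
  {within `[0, 1], continuous (fun x => Im (f x))} -> memL2 f.
Proof. by move=> c1 c2; split; exact: sqI_continuous. Qed.

Lemma L2_linE a u v : (a *: u + v : L2 R) =ae (fun x => a * u x + v x).
Proof.
have h1 := L2_addE (a *: u) v; have h2 := L2_scaleE a u.
by apply: (ae_transfer2 _ h1 h2) => x e1 e2 xI; rewrite e1// e2.
Qed.

Lemma L2ip_linl a u v w : L2ip (a *: u + v) w = a * L2ip u w + L2ip v w.
Proof.
have hm u' : cintI (fun x => u' x * (w x)^*%C) by apply: memL2_mul; exact: L2_mem.
rewrite /L2ip -cintegral_lin//; apply: ae_eq_cintegral => //.
  exact: cintI_lin.
have h := L2_linE a u v; apply: (ae_transfer2 _ h h) => x e _ xI.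
by rewrite e// mulrDl mulrA.
Qed.

Lemma L2ipC u v : L2ip v u = (L2ip u v)^*%C.
Proof.
rewrite /L2ip /cintegral; apply: complex_ext; rewrite ?ReJ ?ImJ /=.
  by apply: eq_intI => x _; rewrite !ReM !ReJ !ImJ; ring.
have [_ h] := memL2_mul (L2_mem u) (L2_mem v).
rewrite -mulN1r -(RintegralZl (- 1) measurable_unit_itv h).
by apply: eq_intI => x _; rewrite !ImM !ReJ !ImJ; ring.
Qed.

(** Separates the four real integrals to which the real-valued results apply. *)
Lemma L2ipE u v : L2ip u v =
  (\int[mu]_(x in I) (Re (u x) * Re (v x)) + \int[mu]_(x in I) (Im (u x) * Im (v x)))
  +i* (\int[mu]_(x in I) (Im (u x) * Re (v x)) - \int[mu]_(x in I) (Re (u x) * Im (v x))).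
Proof.
have [u1 u2] := L2_mem u; have [v1 v2] := L2_mem v.
rewrite /L2ip /cintegral; congr (_ +i* _).
  rewrite -[X in X + _]mul1r -int_lin; [|exact: sqI_mul..].
  by apply: eq_intI => x _; rewrite ReM ReJ ImJ; ring.
rewrite addrC -mulN1r -int_lin; [|exact: sqI_mul..].
by apply: eq_intI => x _; rewrite ImM ReJ ImJ; ring.
Qed.

Lemma L2ip_eq0 u : L2ip u u = 0 -> u = 0.
Proof.
have [u1 u2] := L2_mem u.
rewrite L2ipE => -[h _]; apply: L2_eqP.
have h0 p : sqI p -> \int[mu]_(x in I) (p x * p x) = 0 -> p =ae (fun=> 0).
  move=> hp h1; have hpp := sqI_mul hp hp.
  have : (\int[mu]_(x in I) `|(p x * p x)%:E| = 0)%E.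
    transitivity (\int[mu]_(x in I) (p x * p x)%:E)%E.
      by apply: eq_integral => x _; rewrite gee0_abs// lee_fin -expr2 sqr_ge0.
    by rewrite -[LHS]fineK; [rewrite -[fine _]/(Rintegral _ _ _) h1|exact: integrable_fin_num].
  move=> /(ae_eq_integral_abs mu measurable_unit_itv (measurable_int mu hpp)).
  move=> h2; apply: (ae_transfer2 _ h2 h2) => x e _ xI.
  by have [] := e xI => /eqP; rewrite mulf_eq0 orbb => /eqP.
have ge0 p : 0 <= \int[mu]_(x in I) (p x * p x).
  by apply: Rintegral_ge0 => x _; rewrite -expr2 sqr_ge0.
move/eqP: h; rewrite paddr_eq0 ?ge0// => /andP[/eqP e1 /eqP e2].
have z := @L2_zeroE R.
have := @ae_Re_Im u (fun=> 0) (h0 _ u1 e1) (h0 _ u2 e2).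
move=> hu; apply: (ae_transfer2 _ z hu) => x ez eu xI.
by rewrite ez// eu.
Qed.

End complex_L2.

(** * Weak derivatives, continuous representatives and boundary values *)

Section weak_derivatives.
Context {R : realType}.
Implicit Types (u v w : L2 R) (f g h : R -> R[i]) (p q : R -> R) (a b c : R[i]) (x : R).
Local Notation mu := (@lebesgue_measure R).
Local Notation I := (@unit_itv R).
Local Notation Re := complex.Re.
Local Notation Im := complex.Im.
Local Notation intI f := (mu.-integrable I (EFin \o f)).
Local Notation "f =ae g" := (f = g %[ae @lebesgue_measure R in unit_itv])
  (at level 70).
#[local] Hint Resolve measurable_unit_itv : core.

Definition cprim f x : R[i] :=
  prim (fun t => Re (f t)) x +i* prim (fun t => Im (f t)) x.

Lemma L2_intI u : intI (fun x => Re (u x)) /\ intI (fun x => Im (u x)).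
Proof. exact: memL2_cintI (L2_mem u). Qed.

Lemma cintegral_real f p :
  cintegral (fun x => f x * (p x)%:C) =
  (\int[mu]_(x in I) (Re (f x) * p x)) +i* (\int[mu]_(x in I) (Im (f x) * p x)).
Proof.
rewrite /cintegral; congr (_ +i* _); apply: eq_intI => x _.
  by rewrite ReM /=; ring.
by rewrite ImM /=; ring.
Qed.

Lemma is_wderivP u v : is_wderiv u v <-> forall phi, test_function phi ->
  \int[mu]_(x in I) (Re (u x) * phi^`()%classic x) =
    - (\int[mu]_(x in I) (Re (v x) * phi x)) /\
  \int[mu]_(x in I) (Im (u x) * phi^`()%classic x) =
    - (\int[mu]_(x in I) (Im (v x) * phi x)).
Proof.
split=> h phi /h; rewrite !cintegral_real; first by case.
by move=> [-> ->].
Qed.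

(** Test functions are real, so [du_bois_reymond] applies to the real and imaginary parts
    separately; the converse is [prim_weak_derivative]. *)
Lemma is_wderiv_cprim u v : is_wderiv u v <->
  exists c, u =ae (fun x => c + cprim v x).
Proof.
have [u1 u2] := L2_intI u; have [v1 v2] := L2_intI v.
split.
  move=> /is_wderivP h.
  have [c1 e1] := du_bois_reymond u1 v1 (fun phi t => (h phi t).1).
  have [c2 e2] := du_bois_reymond u2 v2 (fun phi t => (h phi t).2).
  exists (c1 +i* c2); exact: ae_Re_Im.
move=> [[c1 c2] e]; apply/is_wderivP => phi tphi.
have [cphi cdphi] := test_function_continuous tphi.
have cdphi' : {within `[0, 1], continuous (phi^`()%classic)} by exact: continuous_subspaceT.
have hp p d : intI p -> intI (fun x => (d + prim p x) * phi^`()%classic x).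
  move=> hp; apply: intIM => //; apply: intI_continuous => x.
  by apply: cvgD; [exact: cvg_cst|exact: prim_continuous].
rewrite -(prim_weak_derivative c1 v1 tphi) -(prim_weak_derivative c2 v2 tphi).
split; apply: ae_eq_intI; do ?[exact: hp|exact: intIM].
  have e' := ae_Re e; apply: (ae_transfer2 _ e' e') => x h _ xI.
  by rewrite h//= ReD.
have e' := ae_Im e; apply: (ae_transfer2 _ e' e') => x h _ xI.
by rewrite h//= ImD.
Qed.

(** Continuous representatives agree almost everywhere, hence at every point of [[0, 1]], so the
    choice made by [xget] is immaterial. *)
Lemma bvalueE u f x : continuous_rep u f -> 0 <= x <= 1 -> bvalue u x = f x.
Proof.
move=> [f1 f2 fu] x01; rewrite /bvalue; case: xgetP => [c _ [g [g1 g2 gu] <-]|/(_ (f x))].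
  have fg : g =ae f.
    apply: (ae_transfer2 _ gu fu) => y e1 e2 yI.
    by rewrite -e1// -e2.
  apply: complex_ext.
    exact: (continuous_ae_eq g1 f1 (ae_Re fg)).
  exact: (continuous_ae_eq g2 f2 (ae_Im fg)).
by move=> /(_ _)/=; case; exists f.
Qed.

Lemma continuous_rep_cprim u v c : u =ae (fun x => c + cprim v x) ->
  continuous_rep u (fun x => c + cprim v x).
Proof.
have [v1 v2] := L2_intI v.
move=> e; split=> // x.
  rewrite (_ : (fun _ => _) = (fun x => Re c + prim (fun t => Re (v t)) x)).
    by apply: cvgD; [exact: cvg_cst|exact: prim_continuous].
  by apply/funext => y; rewrite ReD.
rewrite (_ : (fun _ => _) = (fun x => Im c + prim (fun t => Im (v t)) x)).
  by apply: cvgD; [exact: cvg_cst|exact: prim_continuous].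
by apply/funext => y; rewrite ImD.
Qed.

Lemma cprim0 f : cprim f 0 = 0.
Proof. by rewrite /cprim !prim0. Qed.

Lemma is_wderiv_rep u v : is_wderiv u v -> exists f, continuous_rep u f.
Proof. by move=> /is_wderiv_cprim[c /continuous_rep_cprim]; exists (fun x => c + cprim v x). Qed.

Lemma is_wderivE u v : is_wderiv u v -> u =ae (fun x => bvalue u 0 + cprim v x) /\
  forall x, 0 <= x <= 1 -> bvalue u x = bvalue u 0 + cprim v x.
Proof.
move=> /is_wderiv_cprim[c e]; have r := continuous_rep_cprim e.
have e0 : bvalue u 0 = c by rewrite (bvalueE r) ?lexx ?ler01// cprim0 addr0.
by rewrite e0; split => // x x01; rewrite (bvalueE r).
Qed.

Lemma continuous_rep_lin a u v f g : continuous_rep u f -> continuous_rep v g ->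
  continuous_rep (a *: u + v) (fun x => a * f x + g x).
Proof.
move=> [f1 f2 fu] [g1 g2 gv]; split=> [x|x|].
- rewrite (_ : (fun _ => _) = (fun x => Re a * Re (f x) - Im a * Im (f x) + Re (g x))).
    by apply: cvgD; [apply: cvgB; apply: cvgMr; [exact: f1|exact: f2]|exact: g1].
  by apply/funext => y; rewrite ReD ReM.
- rewrite (_ : (fun _ => _) = (fun x => Re a * Im (f x) + Im a * Re (f x) + Im (g x))).
    by apply: cvgD; [apply: cvgD; apply: cvgMr; [exact: f2|exact: f1]|exact: g2].
  by apply/funext => y; rewrite ImD ImM.
- have l := L2_linE a u v; have fg := ae_transfer2 (fun x e1 e2 => conj e1 e2) fu gv.
  apply: (ae_transfer2 _ l fg) => x e [e1 e2] xI.
  by rewrite e// e1// e2.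
Qed.

Lemma bvalue_lin a u v u' v' x : is_wderiv u u' -> is_wderiv v v' ->
  0 <= x <= 1 -> bvalue (a *: u + v) x = a * bvalue u x + bvalue v x.
Proof.
move=> /is_wderiv_rep[f hf] /is_wderiv_rep[g hg] x01.
by rewrite (bvalueE (continuous_rep_lin a hf hg))// (bvalueE hf)// (bvalueE hg).
Qed.

Lemma is_wderiv_lin a u v u' v' : is_wderiv u u' -> is_wderiv v v' ->
  is_wderiv (a *: u + v) (a *: u' + v').
Proof.
move=> hu hv phi tphi; have [cphi cdphi] := test_function_continuous tphi.
have cdphi' : {within `[0, 1], continuous (phi^`()%classic)} by exact: continuous_subspaceT.
have L (w w' : L2 R) p : {within `[0, 1], continuous p} ->
    cintegral (fun x => (a *: w + w' : L2 R) x * (p x)%:C) =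
    a * cintegral (fun x => w x * (p x)%:C) + cintegral (fun x => w' x * (p x)%:C).
  move=> cp; have hi (w0 : L2 R) : cintI (fun x => w0 x * (p x)%:C).
    have [w1 w2] := L2_intI w0; split.
      by apply: (intI_ext _ (intIM w1 cp)) => x _; rewrite ReM /=; ring.
    by apply: (intI_ext _ (intIM w2 cp)) => x _; rewrite ImM /=; ring.
  rewrite -cintegral_lin//; apply: ae_eq_cintegral => //; first exact: cintI_lin.
  have l := L2_linE a w w'; apply: (ae_transfer2 _ l l) => x e _ xI.
  by rewrite e// mulrDl mulrA.
by rewrite !L// (hu _ tphi) (hv _ tphi); ring.
Qed.

(** Bumps are test functions, so the difference of two weak derivatives integrates to zero against
    all of them and [bump_ae0] applies. *)
Lemma is_wderiv_unique u v v' : is_wderiv u v -> is_wderiv u v' -> v = v'.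
Proof.
move=> h h'.
apply: L2_eqP; have [v1 v2] := L2_intI v; have [w1 w2] := L2_intI v'.
have e0 p q : intI p -> intI q -> (forall phi, test_function phi ->
    \int[mu]_(x in I) (p x * phi x) = \int[mu]_(x in I) (q x * phi x)) -> p =ae q.
  move=> hp hq H; have hl : intI (fun x => - 1 * p x + q x) by exact: intI_lin.
  have := bump_ae0 hl.
  have /[swap] /[apply] : forall (a b : R) n, 0 < a -> a < b -> b < 1 ->
      \int[mu]_(x in I) ((- 1 * p x + q x) * bumpf a b n x) = 0.
    move=> a b n a0 ab b1.
    have tb : test_function (bumpf a b n).
      apply: (@smooth_test_function _ _ a b) => //; first exact: smooth_bump.
      move=> x xab; apply: bump_out; apply: contra xab; rewrite !in_itv/=.
      by move=> /andP[/ltW -> /ltW ->].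
    have [cb _] := test_function_continuous tb.
    transitivity (\int[mu]_(x in I) (- 1 * (p x * bumpf a b n x) + q x * bumpf a b n x)).
      by apply: eq_intI => x _; ring.
    by rewrite int_lin; [|exact: intIM..]; rewrite H// mulN1r addNr.
  by move=> e; apply: (ae_transfer2 _ e e) => x e1 _ xI; have := e1 xI; lra.
move: h h' => /is_wderivP h /is_wderivP h'; apply: ae_Re_Im; apply: e0 => // phi t.
  by apply: oppr_inj; rewrite -(h _ t).1 -(h' _ t).1.
by apply: oppr_inj; rewrite -(h _ t).2 -(h' _ t).2.
Qed.

Lemma wderivE u v : is_wderiv u v -> wderiv u = v.
Proof.
move=> h; rewrite /wderiv; case: xgetP => [w _ h'|/(_ v)//].
exact: is_wderiv_unique h' h.
Qed.

Lemma H2_is_wderiv u : H2 u ->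
  is_wderiv u (wderiv u) /\ is_wderiv (wderiv u) (wderiv (wderiv u)).
Proof. by move=> [v [w [uv vw]]]; rewrite (wderivE uv) (wderivE vw). Qed.

(** Carries [int_by_parts] to functions equal to primitives only almost everywhere, as
    representatives of [L2] classes are. *)
Lemma int_by_parts_ae (p q u1 u2 : R -> R) (a b : R) : intI p -> intI q ->
  intI (fun x => p x * u2 x) -> intI (fun x => u1 x * q x) ->
  u1 =ae (fun x => a + prim p x) -> u2 =ae (fun x => b + prim q x) ->
  \int[mu]_(x in I) (p x * u2 x) + \int[mu]_(x in I) (u1 x * q x) =
  (a + prim p 1) * (b + prim q 1) - a * b.
Proof.
move=> hp hq h1 h2 e1 e2; rewrite -(int_by_parts a b hp hq).
have hc (r : R -> R) (d : R) : intI r -> {within `[0, 1], continuous (fun x => d + prim r x)}.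
  by move=> hr x; apply: cvgD; [exact: cvg_cst|exact: prim_continuous].
rewrite -[X in X + _]mul1r -int_lin//; apply: ae_eq_intI.
- exact: intI_lin.
- apply: (@intI_ext _ (fun x => 1 * (p x * (b + prim q x)) + q x * (a + prim p x))).
    by move=> x _; ring.
  by apply: intI_lin; apply: intIM => //; exact: hc.
- by apply: (ae_transfer2 _ e1 e2) => x E1 E2 xI; rewrite E1// E2// mul1r.
Qed.

Lemma L2ip_by_parts u1 u2 v1 v2 : is_wderiv u1 v1 -> is_wderiv u2 v2 ->
  L2ip v1 u2 + L2ip u1 v2 =
  bvalue u1 1 * (bvalue u2 1)^*%C - bvalue u1 0 * (bvalue u2 0)^*%C.
Proof.
move=> /is_wderivE[e1 b1] /is_wderivE[e2 b2].
rewrite (b1 1) ?(b2 1) ?ler01 ?lexx//.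
move: (bvalue u1 0) (bvalue u2 0) e1 e2 => c1 c2 e1 e2 {b1 b2}.
have [v1r v1i] := L2_intI v1; have [v2r v2i] := L2_intI v2.
have [mu1r mu1i] := L2_mem u1; have [mu2r mu2i] := L2_mem u2.
have [mv1r mv1i] := L2_mem v1; have [mv2r mv2i] := L2_mem v2.
have er u v c : u =ae (fun x => c + cprim v x) ->
    (fun x => Re (u x)) =ae (fun x => Re c + prim (fun t => Re (v t)) x).
  by move=> /ae_Re e; apply: (ae_transfer2 _ e e) => x h _ xI; rewrite h// ReD.
have ei u v c : u =ae (fun x => c + cprim v x) ->
    (fun x => Im (u x)) =ae (fun x => Im c + prim (fun t => Im (v t)) x).
  by move=> /ae_Im e; apply: (ae_transfer2 _ e e) => x h _ xI; rewrite h// ImD.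
(* Four real integrations by parts, one for each pairing of real and imaginary parts. *)
have rr := int_by_parts_ae v1r v2r (sqI_mul mv1r mu2r) (sqI_mul mu1r mv2r)
  (er _ _ _ e1) (er _ _ _ e2).
have ii := int_by_parts_ae v1i v2i (sqI_mul mv1i mu2i) (sqI_mul mu1i mv2i)
  (ei _ _ _ e1) (ei _ _ _ e2).
have ir := int_by_parts_ae v1i v2r (sqI_mul mv1i mu2r) (sqI_mul mu1i mv2r)
  (ei _ _ _ e1) (er _ _ _ e2).
have ri := int_by_parts_ae v1r v2i (sqI_mul mv1r mu2i) (sqI_mul mu1r mv2i)
  (er _ _ _ e1) (ei _ _ _ e2).
rewrite !L2ipE; apply: complex_ext; rewrite !(ReD, ImD, ReN, ImN, ReM, ImM, ReJ, ImJ) /=.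
  by rewrite addrACA rr ii; ring.
by rewrite addrACA -opprD ir ri; ring.
Qed.

(** The primitive [c + cprim v] is continuous, so it represents a class in [L2] and its boundary
    values can be read off. *)
Lemma wderiv_exists v c : exists u,
  [/\ is_wderiv u v, bvalue u 0 = c & bvalue u 1 = c + cprim v 1].
Proof.
have [v1 v2] := L2_intI v.
have hm : memL2 (fun x => c + cprim v x).
  apply: memL2_continuous => x.
    rewrite (_ : (fun _ => _) = (fun x => Re c + prim (fun t => Re (v t)) x)).
      by apply: cvgD; [exact: cvg_cst|exact: prim_continuous].
    by apply/funext => y; rewrite ReD.
  rewrite (_ : (fun _ => _) = (fun x => Im c + prim (fun t => Im (v t)) x)).
    by apply: cvgD; [exact: cvg_cst|exact: prim_continuous].
  by apply/funext => y; rewrite ImD.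
have e := L2classE hm; have r := continuous_rep_cprim e.
exists (L2class hm); split.
- by apply/is_wderiv_cprim; exists c.
- by rewrite (bvalueE r) ?lexx ?ler01// cprim0 addr0.
- by rewrite (bvalueE r) ?lexx ?ler01.
Qed.

(** * Classical derivatives as weak derivatives *)

Definition cderiv f g := forall x,
  is_derive x 1 (fun t => Re (f t)) (Re (g x)) /\
  is_derive x 1 (fun t => Im (f t)) (Im (g x)).

Definition ccont f := continuous (fun x => Re (f x)) /\ continuous (fun x => Im (f x)).

Lemma ccont_memL2 f : ccont f -> memL2 f.
Proof. by move=> [f1 f2]; apply: memL2_continuous; exact: continuous_subspaceT. Qed.

Lemma cderiv_ccont f g : cderiv f g -> ccont f.
Proof.
by move=> h; split=> x; apply/differentiable_continuous/derivable1_diffP;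
  [case: (h x).1|case: (h x).2].
Qed.

Lemma ccont_rep f (hf : ccont f) : continuous_rep (L2class (ccont_memL2 hf)) f.
Proof.
by case: (hf) => f1 f2; split; [exact: continuous_subspaceT..|exact: L2classE].
Qed.

(** By [prim_derive], [f] is [f 0] plus the primitive of [g]; [ae_eq_prim] replaces [g] by the
    representative of its class. *)
Lemma cderiv_is_wderiv f g (hf : ccont f) (hg : ccont g) : cderiv f g ->
  is_wderiv (L2class (ccont_memL2 hf)) (L2class (ccont_memL2 hg)).
Proof.
move=> h; apply/is_wderiv_cprim; exists (f 0).
have [G1 G2] := L2_intI (L2class (ccont_memL2 hg)).
have [g1 g2] := memL2_cintI (ccont_memL2 hg).
have e := L2classE (ccont_memL2 hg); have ef := L2classE (ccont_memL2 hf).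
apply: (ae_transfer2 _ ef ef) => x ex _ xI; rewrite ex//.
move: xI; rewrite /unit_itv/= in_itv/= => /andP[x0 x1].
have hr : continuous (fun x => Re (g x)) := hg.1.
have hi : continuous (fun x => Im (g x)) := hg.2.
apply: complex_ext; rewrite ?(ReD, ImD) /=.
  rewrite (ae_eq_prim G1 g1 (ae_Re e) (ltW x1)).
  exact: (prim_derive (fun t => (h t).1) hr (ltW x0)).
rewrite (ae_eq_prim G2 g2 (ae_Im e) (ltW x1)).
exact: (prim_derive (fun t => (h t).2) hi (ltW x0)).
Qed.

End weak_derivatives.

(** * Solutions on one edge *)

Section edge_functions.
Context {R : realType}.
Implicit Types (u v w : L2 R) (f g : R -> R[i]) (a b c z nu : R[i]) (x : R).
Local Notation Re := complex.Re.
Local Notation Im := complex.Im.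
Local Notation "f =ae g" := (f = g %[ae @lebesgue_measure R in unit_itv])
  (at level 70).

Lemma cexpD a b : cexp (a + b) = cexp a * cexp b.
Proof.
apply: complex_ext; rewrite /cexp !(ReM, ImM, ReD, ImD) /= expRD.
  by rewrite cosD; ring.
by rewrite sinD; ring.
Qed.

Lemma cexp0 : cexp (0 : R[i]) = 1.
Proof. by apply: complex_ext; rewrite /cexp !(ReM, ImM) /= expR0 cos0 sin0; ring. Qed.

Lemma cexpNK a : cexp a * cexp (- a) = 1.
Proof. by rewrite -cexpD subrr cexp0. Qed.

Lemma sin0C : csin (0 : R[i]) = 0.
Proof. by rewrite /csin mulr0 oppr0 subrr mul0r. Qed.

Lemma csinN z : csin (- z) = - csin z.
Proof. by rewrite /csin mulrN opprK -opprB mulNr. Qed.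

Lemma ccosN z : ccos (- z) = ccos z.
Proof. by rewrite /ccos mulrN opprK addrC. Qed.

Lemma iC_neq0 : 'i%C != 0 :> R[i].
Proof. by rewrite eq_complex /= oner_eq0 andbF. Qed.

Lemma iCiC : 'i%C * 'i%C = -1 :> R[i].
Proof. by apply: complex_ext; rewrite !(ReM, ImM) /=; ring. Qed.

(** If the sine vanishes, the two exponentials coincide and the cosine equals their common value,
    which is invertible by [cexpNK]. *)
Lemma csin_ccos_neq0 z : csin z = 0 -> ccos z != 0.
Proof.
have n2 : (2 : R[i]) != 0 by rewrite pnatr_eq0.
move=> /eqP; rewrite mulf_eq0 invr_eq0 mulf_eq0 (negbTE n2) (negbTE iC_neq0) !orbF subr_eq0.
move=> /eqP e; rewrite mulf_eq0 invr_eq0 (negbTE n2) orbF e.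
rewrite -mulr2n -mulr_natr mulf_eq0 (negbTE n2) orbF.
apply/eqP => e0; have := cexpNK ('i%C * z); rewrite e0 mulr0.
by move/eqP; rewrite eq_sym oner_eq0.
Qed.

Lemma cderiv_lin a f g f' g' : cderiv f f' -> cderiv g g' ->
  cderiv (fun x => a * f x + g x) (fun x => a * f' x + g' x).
Proof.
move=> hf hg x; have [f1 f2] := hf x; have [g1 g2] := hg x; split.
  have := is_deriveD (is_deriveB (is_deriveZ (Re a) f1) (is_deriveZ (Im a) f2)) g1.
  rewrite ReD ReM; congr is_derive.
  by apply/funext => t; rewrite ReD ReM.
have := is_deriveD (is_deriveD (is_deriveZ (Re a) f2) (is_deriveZ (Im a) f1)) g2.
rewrite ImD ImM; congr is_derive.
by apply/funext => t; rewrite ImD ImM.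
Qed.

Lemma cderiv_cst c : cderiv (fun=> c) (fun=> 0).
Proof. by move=> x; split; exact: is_derive_cst. Qed.

Lemma cderivZ a f f' : cderiv f f' -> cderiv (fun x => a * f x) (fun x => a * f' x).
Proof.
move=> /(cderiv_lin a)/(_ (cderiv_cst 0)); congr cderiv; apply/funext => x.
  by rewrite addr0.
by rewrite addr0.
Qed.

Lemma cderiv_ext f g f' g' : cderiv f f' -> f =1 g -> f' =1 g' -> cderiv g g'.
Proof. by move=> h /funext <- /funext <-. Qed.

Lemma cderiv_cexp a b :
  cderiv (fun x => cexp (a * x%:C + b)) (fun x => a * cexp (a * x%:C + b)).
Proof.
have aff (r s : R) x : is_derive x (1 : R) (fun t => r * t + s) r.
  apply: (is_derive_eq (_ : is_derive x (1:R) ((r *: (@id R)) + cst s) (r *: 1 + 0))).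
  by rewrite addr0 /GRing.scale/= mulr1.
have rE t : Re (a * t%:C + b) = Re a * t + Re b by rewrite ReD ReM /= mulr0 subr0.
have iE t : Im (a * t%:C + b) = Im a * t + Im b by rewrite ImD ImM /= mulr0 add0r.
move=> x.
have dE := @is_derive1_comp _ expR (fun t => Re a * t + Re b) x _ _
  (is_derive_expR _) (aff (Re a) (Re b) x).
have dC := @is_derive1_comp _ (@cos R) (fun t => Im a * t + Im b) x _ _
  (is_derive_cos _) (aff (Im a) (Im b) x).
have dS := @is_derive1_comp _ (@sin R) (fun t => Im a * t + Im b) x _ _
  (is_derive_sin _) (aff (Im a) (Im b) x).
split.
  have := is_deriveM dE dC.
  rewrite (_ : (_ * _) = (fun t => Re (cexp (a * t%:C + b)))); last first.
    by apply/funext => t; rewrite /cexp ReM /= rE iE !fctE /=; ring.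
  move=> H; apply: (is_derive_eq H).
  by rewrite ReM /cexp ReM ImM /= rE iE /GRing.scale/=; ring.
have := is_deriveM dE dS.
rewrite (_ : (_ * _) = (fun t => Im (cexp (a * t%:C + b)))); last first.
  by apply/funext => t; rewrite /cexp ImM /= rE iE !fctE /=; ring.
move=> H; apply: (is_derive_eq H).
by rewrite ImM /cexp ReM ImM /= rE iE /GRing.scale/=; ring.
Qed.

Lemma cderiv_csin nu : cderiv (fun x => csin (nu * x%:C - nu))
  (fun x => nu * ccos (nu * x%:C - nu)).
Proof.
have n2 : (2 : R[i]) != 0 by rewrite pnatr_eq0.
have h := cderiv_lin ((2 * 'i%C)^-1) (cderiv_cexp ('i%C * nu) (- ('i%C * nu)))
  (cderivZ (- (2 * 'i%C)^-1) (cderiv_cexp (- ('i%C * nu)) ('i%C * nu))).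
have e1 x : 'i%C * (nu * x%:C - nu) = 'i%C * nu * x%:C - 'i%C * nu by ring.
have e2 x : - ('i%C * nu * x%:C - 'i%C * nu) = - ('i%C * nu) * x%:C + 'i%C * nu by ring.
apply: (cderiv_ext h) => x.
  by rewrite /csin e1 e2 mulrBl; ring.
rewrite /ccos e1 e2; move: (cexp _) (cexp _) => X Y.
by have i0 := iC_neq0; field; rewrite i0.
Qed.

Lemma cderiv_ccos nu : cderiv (fun x => nu * ccos (nu * x%:C - nu))
  (fun x => - nu ^+ 2 * csin (nu * x%:C - nu)).
Proof.
have n2 : (2 : R[i]) != 0 by rewrite pnatr_eq0.
have h := cderiv_lin (nu / 2) (cderiv_cexp ('i%C * nu) (- ('i%C * nu)))
  (cderivZ (nu / 2) (cderiv_cexp (- ('i%C * nu)) ('i%C * nu))).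
have e1 x : 'i%C * (nu * x%:C - nu) = 'i%C * nu * x%:C - 'i%C * nu by ring.
have e2 x : - ('i%C * nu * x%:C - 'i%C * nu) = - ('i%C * nu) * x%:C + 'i%C * nu by ring.
apply: (cderiv_ext h) => x.
  by rewrite /ccos e1 e2; ring.
rewrite /csin e1 e2; move: (cexp _) (cexp _) => X Y.
(* [field] treats the imaginary unit as an indeterminate, so its square has to be introduced by
   hand. *)
have -> : - nu ^+ 2 = nu ^+ 2 * ('i%C * 'i%C) by rewrite iCiC mulrN1.
by have i0 := iC_neq0; field; rewrite i0.
Qed.

(** The sine is not normalised at 0, so that the lemma also covers [csin nu = 0], the case to be
    excluded for [lam] in the resolvent set. *)
Lemma sine_edge nu : exists s, [/\ H2 s, wderiv (wderiv s) = - nu ^+ 2 *: s,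
  bvalue s 0 = - csin nu /\ bvalue s 1 = 0, bvalue (wderiv s) 0 = nu * ccos nu &
  s =ae (fun x => csin (nu * x%:C - nu))].
Proof.
have d1 := cderiv_csin nu; have d2 := cderiv_ccos nu.
have c0 := cderiv_ccont d1; have c1 := cderiv_ccont d2.
have d3 := cderivZ (- nu ^+ 2) d1; have c2 := cderiv_ccont d3.
pose s := L2class (ccont_memL2 c0).
have w1 := cderiv_is_wderiv c0 c1 d1; have w2 := cderiv_is_wderiv c1 c2 d2.
have r0 := ccont_rep c0; have r1 := ccont_rep c1.
exists s; split.
- by do 2 eexists; split; [exact: w1|exact: w2].
- rewrite (wderivE w1) (wderivE w2); apply: L2_eqP.
  have e1 := L2classE (ccont_memL2 c2).
  have e2 := L2_scaleE (- nu ^+ 2) s; have e3 := L2classE (ccont_memL2 c0).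
  apply: (ae_and4 _ e1 e2 e3 e3) => x h1 h2 h3 _ xI.
  by rewrite h1// h2// h3.
- by rewrite (bvalueE r0) ?(bvalueE r0) ?lexx ?ler01// mulr0 add0r csinN mulr1 subrr sin0C.
- by rewrite (wderivE w1) (bvalueE r1) ?lexx ?ler01// mulr0 add0r ccosN.
- exact: L2classE.
Qed.

(** The analogue of the sine at frequency 0; multiples of it also adjust the value at 0 without
    affecting the second derivative. *)
Lemma affine_edge : exists s, [/\ H2 s, wderiv (wderiv s) = 0,
  bvalue s 0 = 1 /\ bvalue s 1 = 0, bvalue (wderiv s) 0 = - 1 &
  s =ae (fun x => 1 - x%:C)].
Proof.
have d1 : cderiv (fun x => 1 - x%:C) (fun=> - 1 : R[i]).
  move=> x; split.
    apply: (is_derive_eq (_ : is_derive x (1:R) (cst 1 - (@id R)) (0 - 1))).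
    by rewrite /= sub0r.
  by rewrite (_ : (fun _ => _) = cst (0 - 0)) /= ?oppr0; first exact: is_derive_cst.
have d2 := cderiv_cst (- 1); have d3 := cderiv_cst 0.
have c0 := cderiv_ccont d1; have c1 := cderiv_ccont d2; have c2 := cderiv_ccont d3.
have w1 := cderiv_is_wderiv c0 c1 d1; have w2 := cderiv_is_wderiv c1 c2 d2.
have r0 := ccont_rep c0; have r1 := ccont_rep c1.
exists (L2class (ccont_memL2 c0)); split.
- by do 2 eexists; split; [exact: w1|exact: w2].
- rewrite (wderivE w1) (wderivE w2); apply: L2_eqP.
  have e1 := L2classE (ccont_memL2 c2); have e2 := @L2_zeroE R.
  by apply: (ae_transfer2 _ e1 e2) => x h1 h2 xI; rewrite h1// h2.
- by rewrite !(bvalueE r0) ?lexx ?ler01// subr0 subrr.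
- by rewrite (wderivE w1) (bvalueE r1) ?lexx ?ler01.
- exact: L2classE.
Qed.

Lemma H2_lin a u v : H2 u -> H2 v -> [/\ H2 (a *: u + v),
  wderiv (a *: u + v) = a *: wderiv u + wderiv v,
  wderiv (wderiv (a *: u + v)) = a *: wderiv (wderiv u) + wderiv (wderiv v),
  forall x, 0 <= x <= 1 -> bvalue (a *: u + v) x = a * bvalue u x + bvalue v x &
  forall x, 0 <= x <= 1 ->
    bvalue (wderiv (a *: u + v)) x = a * bvalue (wderiv u) x + bvalue (wderiv v) x].
Proof.
move=> /H2_is_wderiv[u1 u2] /H2_is_wderiv[v1 v2].
have w1 := is_wderiv_lin a u1 v1; have w2 := is_wderiv_lin a u2 v2.
rewrite (wderivE w1) (wderivE w2); split => //.
- by exists (a *: wderiv u + wderiv v); eexists; split; [exact: w1|exact: w2].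
- by move=> x; exact: bvalue_lin u1 v1.
- by move=> x; exact: bvalue_lin u2 v2.
Qed.

Lemma zero_edge : [/\ H2 (0 : L2 R), wderiv (0 : L2 R) = 0 &
  forall x, 0 <= x <= 1 -> bvalue (0 : L2 R) x = 0].
Proof.
have [s [Hs _ _ _ _]] := affine_edge; have [] := H2_lin (- 1) Hs Hs.
by rewrite !scaleN1r !addNr => h w _ b _; split=> // x /b ->; rewrite mulN1r addNr.
Qed.

(** Integrate twice, with the second constant [- cprim v1 1] chosen to give the value 0 at 1, then
    cancel the value at 0 by a multiple of [affine_edge]. *)
Lemma source_edge v : exists s, [/\ H2 s, wderiv (wderiv s) = v,
  bvalue s 0 = 0 & bvalue s 1 = 0].
Proof.
have [v1 [w1 _ _]] := wderiv_exists v 0.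
have [v0 [w0 b0 b1]] := wderiv_exists v1 (- cprim v1 1).
have Hv0 : H2 v0 by exists v1, v.
have [s [Hs ds [s0 s1] _ _]] := affine_edge.
have [h _ d b _] := H2_lin (cprim v1 1) Hs Hv0.
exists (cprim v1 1 *: s + v0); split => //.
- by rewrite d ds scaler0 add0r (wderivE w0) (wderivE w1).
- by rewrite b ?lexx ?ler01// s0 b0 mulr1 subrr.
- by rewrite b ?lexx ?ler01// s1 b1 mulr0 add0r addNr.
Qed.

(** Two integrations by parts share the term [L2ip (wderiv u) (wderiv v)]; the contributions of the
    endpoint 1 vanish. *)
Lemma green_edge u v : H2 u -> H2 v -> bvalue u 1 = 0 -> bvalue v 1 = 0 ->
  L2ip (wderiv (wderiv u)) v - L2ip u (wderiv (wderiv v)) =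
  bvalue u 0 * (bvalue (wderiv v) 0)^*%C - bvalue (wderiv u) 0 * (bvalue v 0)^*%C.
Proof.
move=> /H2_is_wderiv[u1 u2] /H2_is_wderiv[v1 v2] ub vb.
have e1 := L2ip_by_parts u2 v1; have e2 := L2ip_by_parts u1 v2.
rewrite ub mul0r in e2; rewrite vb (_ : 0^*%C = 0) ?mulr0 in e1; last first.
  by apply: complex_ext; rewrite ?ReJ ?ImJ /= ?oppr0.
have -> : L2ip (wderiv (wderiv u)) v = - (bvalue (wderiv u) 0 * (bvalue v 0)^*%C)
    - L2ip (wderiv u) (wderiv v) by apply/eqP; rewrite eq_sym subr_eq e1 sub0r.
have -> : L2ip u (wderiv (wderiv v)) = - (bvalue u 0 * (bvalue (wderiv v) 0)^*%C)
    - L2ip (wderiv u) (wderiv v) by apply/eqP; rewrite eq_sym subr_eq addrC e2 sub0r.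
ring.
Qed.

End edge_functions.

(** * Operators on the star graph *)

Section star_graph_operators.
Context {R : realType}.
Variables np nm : nat.
Hypothesis np_gt0 : (0 < np)%N.
Local Notation N := (np + nm)%N.
Local Notation L2G := {ffun 'I_N -> L2 R}.
Implicit Types (f g h : L2G) (lam mu a c : R[i]) (j k : 'I_N).
Local Notation A := (@opA R np nm).
Local Notation B := (@opB R np nm).
Local Notation G0 := (@Gamma0 R np nm).
Local Notation G1 := (@Gamma1 R np nm).

(* Locked: unification must not unfold the finite functions T f. *)
Definition actT : L2G -> L2G := locked (action (@opT R np nm)).
Local Notation T := actT.

Lemma actTE : action (@opT R np nm) = actT.
Proof. by rewrite /actT -lock. Qed.

Lemma shiftTE lam f : shiftop (@opT R np nm) lam f = T f - lam *: f.
Proof. by rewrite -actTE. Qed.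

Lemma shiftAE lam f : shiftop A lam f = T f - lam *: f.
Proof. by rewrite -actTE. Qed.

Lemma shiftBE lam f : shiftop B lam f = T f - lam *: f.
Proof. by rewrite -actTE. Qed.

(** With this sign the Krein form is a single signed sum, and [T] acts on edge [j] as minus the sign
    times the second derivative. *)
Definition sgn_edge (j : 'I_N) : R[i] := if (j < np)%N then 1 else - 1.
Local Notation eps := sgn_edge.

Lemma sgn_edgeK j : eps j * eps j = 1.
Proof. by rewrite /eps; case: ifP => _; rewrite ?mulr1// mulrNN mulr1. Qed.

Lemma kreinE f g : krein f g = \sum_j eps j * L2ip (f j) (g j).
Proof.
rewrite /krein [RHS](bigID (fun j : 'I_N => (j < np)%N)) /=; congr (_ + _).
  by apply: eq_bigr => j jn; rewrite /eps jn mul1r.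
rewrite -sumrN; apply: eq_big => [j|j]; first by rewrite -leqNgt.
by rewrite leqNgt => /negbTE jn; rewrite /eps jn mulN1r.
Qed.

Lemma opTE f j : T f j = - eps j *: wderiv (wderiv (f j)).
Proof.
by rewrite -actTE /= ffunE /eps; case: ifP => _; rewrite ?scaleN1r// opprK scale1r.
Qed.

Lemma ffun_linE a f g j : (a *: f + g) j = a *: f j + g j.
Proof. by rewrite !ffunE. Qed.

Definition domT : set L2G := opdom (@opT R np nm).

Definition edge0 : 'I_N := Ordinal (ltn_addr nm np_gt0).

Lemma Gamma0E f j : domT f -> G0 f = bvalue (f j) 0.
Proof.
move=> [_ _ h]; rewrite /Gamma0; case: xgetP => [c _ /(_ j)->//|].
by move=> /(_ (bvalue (f j) 0)) /=; case => k; exact: h.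
Qed.

Lemma domT_lin a f g : domT f -> domT g -> [/\ domT (a *: f + g),
  T (a *: f + g) = a *: T f + T g, G0 (a *: f + g) = a * G0 f + G0 g &
  G1 (a *: f + g) = a * G1 f + G1 g].
Proof.
move=> df dg; have [fH f1 f0] := df; have [gH g1 g0] := dg.
have E := ffun_linE a f g.
have l j := H2_lin a (fH j) (gH j).
have b0 : 0 <= (0 : R) <= 1 by rewrite lexx ler01.
have b1 : 0 <= (1 : R) <= 1 by rewrite lexx ler01.
have lb j x : 0 <= x <= 1 ->
    bvalue ((a *: f + g) j) x = a * bvalue (f j) x + bvalue (g j) x.
  by move=> x01; rewrite E; case: (l j) => _ _ _ ->.
have d : domT (a *: f + g).
  split.
  - by move=> j; rewrite E; case: (l j).
  - by move=> j; rewrite lb// f1 g1 mulr0 addr0.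
  - by move=> j k; rewrite !lb// (f0 j k) (g0 j k).
split => //.
- apply/ffunP => j; rewrite ffun_linE !opTE E.
  case: (l j) => _ _ -> _ _.
  by rewrite scalerDr !scalerA mulrC.
- have e := Gamma0E edge0 d.
  have ef := Gamma0E edge0 df.
  have eg := Gamma0E edge0 dg.
  rewrite e ef eg.
  exact: (lb edge0 0 b0).
- rewrite /Gamma1 mulr_sumr -big_split; apply: eq_bigr => j _ /=; rewrite E.
  by case: (l j) => _ _ _ _ ->.
Qed.

(** * The Krein form and Green's identity *)

Lemma L2ip0l (u : L2 R) : L2ip 0 u = 0.
Proof.
by have := L2ip_linl (- 1) u u u; rewrite scaleN1r addNr => ->; rewrite mulN1r addNr.
Qed.

Lemma L2ipZl a (u v : L2 R) : L2ip (a *: u) v = a * L2ip u v.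
Proof. by rewrite -[a *: u]addr0 L2ip_linl L2ip0l addr0. Qed.

Lemma L2ipZr a (u v : L2 R) : L2ip u (a *: v) = a^*%C * L2ip u v.
Proof. by rewrite ![L2ip u _]L2ipC L2ipZl rmorphM. Qed.

Lemma krein_linl a f g h : krein (a *: f + g) h = a * krein f h + krein g h.
Proof.
rewrite !kreinE mulr_sumr -big_split; apply: eq_bigr => j _ /=.
by rewrite !ffunE L2ip_linl; ring.
Qed.

Lemma krein_linr a f g h : krein h (a *: f + g) = a^*%C * krein h f + krein h g.
Proof.
rewrite !kreinE mulr_sumr -big_split; apply: eq_bigr => j _ /=.
rewrite !ffunE ![L2ip (h j) _]L2ipC L2ip_linl rmorphD rmorphM /=; ring.
Qed.

Lemma kreinZr a f h : krein h (a *: f) = a^*%C * krein h f.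
Proof.
rewrite !kreinE mulr_sumr; apply: eq_bigr => j _ /=.
by rewrite !ffunE L2ipZr; ring.
Qed.

(** The sign of an edge enters once through [T] and once through the form, so it squares to 1 and
    the boundary terms of [green_edge] add up unsigned. *)
Lemma green f g : domT f -> domT g ->
  krein (T f) g - krein f (T g) = G1 f * (G0 g)^*%C - G0 f * (G1 g)^*%C.
Proof.
move=> df dg; have [fH f1 _] := df; have [gH g1 _] := dg.
rewrite !kreinE -sumrB /Gamma1 rmorph_sum mulr_suml mulr_sumr -sumrB.
apply: eq_bigr => j _; have := green_edge (fH j) (gH j) (f1 j) (g1 j).
rewrite (Gamma0E j df) (Gamma0E j dg) !opTE L2ipZl.
rewrite L2ipZr.
have -> : (- eps j)^*%C = - eps j.
  by rewrite /eps; case: ifP => _; apply: complex_ext; rewrite ?ReJ ?ImJ /= ?oppr0.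
move=> e; transitivity (- (eps j * eps j) *
  (L2ip (wderiv (wderiv (f j))) (g j) - L2ip (f j) (wderiv (wderiv (g j))))).
  by ring.
by rewrite e sgn_edgeK; ring.
Qed.

(** Pairing [f] with its own component on a single edge gives, up to sign, the squared norm of that
    component. *)
Lemma krein_nondegenerate f : (forall h, krein h f = 0) -> f = 0.
Proof.
move=> h0; apply/ffunP => j; rewrite ffunE; apply: L2ip_eq0.
have := h0 [ffun k => if k == j then f j else 0].
rewrite kreinE (bigD1 j)//= big1 => [|k kj].
  rewrite ffunE eqxx addr0 => /eqP; rewrite mulf_eq0 => /orP[|/eqP//].
  by rewrite /eps; case: ifP; rewrite ?oppr_eq0 oner_eq0.
by rewrite ffunE (negbTE kj) L2ip0l mulr0.
Qed.

(** This is the element of [ker T] used at [lam = 0]. Its nonzero [Gamma1] also makes it a corrector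
    for [Gamma1]. *)
Lemma affine_star : exists f, [/\ domT f, T f = 0, G0 f = 1, G1 f = - N%:R &
  forall j, (f j : R -> R[i]) = (fun x => 1 - x%:C)
    %[ae @lebesgue_measure R in unit_itv]].
Proof.
have [s [Hs d2 [s0 s1] ds e]] := @affine_edge R.
pose f : L2G := [ffun=> s].
have df : domT f by split => [j|j|j k]; rewrite !ffunE.
exists f; split => //.
- by apply/ffunP => j; rewrite opTE !ffunE d2 scaler0.
- by rewrite (Gamma0E edge0 df) ffunE.
- rewrite /Gamma1 (eq_bigr (fun=> - 1)); last by move=> j _; rewrite ffunE ds.
  by rewrite sumr_const card_ord mulNrn.
- by move=> j; rewrite ffunE.
Qed.

Lemma domT0 : domT 0.
Proof.
have [f [df _ _ _ _]] := affine_star; have [d _ _ _] := domT_lin (- 1) df df.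
by move: d; rewrite scaleN1r addNr.
Qed.

Lemma domT_sub f g : domT f -> domT g -> [/\ domT (f - g),
  T (f - g) = T f - T g, G0 (f - g) = G0 f - G0 g & G1 (f - g) = G1 f - G1 g].
Proof.
move=> df dg; have [] := domT_lin (- 1) dg df.
by rewrite !scaleN1r !mulN1r ![- _ + _]addrC.
Qed.

Lemma domT0E : [/\ T 0 = 0, G0 0 = 0 & G1 0 = 0].
Proof. by have [_] := domT_sub domT0 domT0; rewrite !subrr. Qed.

Lemma domTZ a f : domT f -> [/\ domT (a *: f), T (a *: f) = a *: T f,
  G0 (a *: f) = a * G0 f & G1 (a *: f) = a * G1 f].
Proof.
move=> df; have [t0 g0 g1] := domT0E.
by have [] := domT_lin a df domT0; rewrite t0 g0 g1 !addr0.
Qed.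

(** * Surjectivity and selfadjointness of [B] *)

(** Solve on each edge with value 0 at both ends, which makes the values at the centre agree; then
    restore [Gamma1 f = 0] by an element of [ker T]. *)
Lemma opB_surj h : exists f, [/\ domT f, G1 f = 0 & T f = h].
Proof.
have /choice[p hp] : forall j, exists s : L2 R, [/\ H2 s,
    wderiv (wderiv s) = - eps j *: h j, bvalue s 0 = 0 & bvalue s 1 = 0].
  by move=> j; exact: source_edge.
pose f : L2G := [ffun j => p j].
have df : domT f.
  split => [j|j|j k]; rewrite !ffunE; first by case: (hp j).
    by case: (hp j).
  by case: (hp j) => _ _ -> _; case: (hp k) => _ _ -> _.
have [l [dl tl _ g1l _]] := affine_star.
(* [Gamma1] of the affine function is [- N%:R], whence the coefficient [G1 f / N%:R]. *)
have [d t _ g1] := domT_lin (G1 f / N%:R) dl df.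
have N0 : (N%:R : R[i]) != 0 by rewrite pnatr_eq0 -lt0n addn_gt0 np_gt0.
exists (G1 f / N%:R *: l + f); split => //.
  by rewrite g1 g1l mulrN divfK// addNr.
rewrite t tl scaler0 add0r; apply/ffunP => j; rewrite opTE ffunE.
by case: (hp j) => _ -> _ _; rewrite scalerA mulrNN sgn_edgeK scale1r.
Qed.

Lemma opB_selfadjoint : selfadjoint (@krein R np nm) B.
Proof.
have sym f g : domT f -> domT g -> G1 f = 0 -> G1 g = 0 ->
    krein (T f) g = krein f (T g).
  move=> df dg f1 g1; apply/eqP; rewrite -subr_eq0 green// f1 g1 mul0r.
  by rewrite conjc0 mulr0 subrr.
have BE : action B = T by rewrite -actTE.
apply/seteqP; split => [[g h] [[dg g1] e] f [df f1]|[g h] H].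
  have -> : h = T g by rewrite -BE; exact: e.
  change (krein (B f) g = krein f (T g)); rewrite BE.
  exact: (sym f g df dg f1 g1).
have [g' [dg' g1' Tg']] := opB_surj h.
suff -> : g = g' by split; [split|rewrite BE].
apply/eqP; rewrite -subr_eq0; apply/eqP; apply: krein_nondegenerate => k.
(* Surjectivity is used again here: every vector [k] is [T f] with [f] in the domain of [B]. *)
have [f [df f1 <-]] := opB_surj k.
rewrite addrC -scaleN1r krein_linr (sym f g')// Tg'.
have -> : krein (T f) g = krein f h by rewrite -BE; exact: (H f).
by rewrite rmorphN1 mulN1r addNr.
Qed.

(** * Injectivity of [A - lam] and explicit solutions *)

(** Isolated from membership in the resolvent set because only this much is established at the
    conjugate of [lam]. *)
Definition A_injective lam :=
  forall f, domT f -> G0 f = 0 -> T f = lam *: f -> f = 0.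

Lemma resolvent_A_injective lam : rhoA np nm lam -> A_injective lam.
Proof.
move=> [[_ inj _] _] f df f0 Tf.
have [t0 g0 _] := domT0E.
have d0 : opdom A 0 by split; [exact: domT0|].
have dA : opdom A f by split.
apply: inj; [exact: mem_set|exact: mem_set|].
by rewrite !shiftAE t0 Tf scaler0 !subrr.
Qed.

(** By Green's identity, an eigenvector at the conjugate of [lam] is orthogonal to the range of
    [A - lam], which is the whole space. *)
Lemma symmetric_A_injective lam : rhoA np nm lam -> A_injective (lam^*%C).
Proof.
move=> [[_ _ surj] _] f df f0 Tf; apply: krein_nondegenerate => h.
have [g [dg g0] <-] := surj h Logic.I.
have := green dg df; rewrite f0 g0 conjc0 mulr0 mul0r subrr.
rewrite Tf kreinZr conjcK.
by move=> e; rewrite shiftAE [T g - _]addrC -scaleNr krein_linl mulNr addrC.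
Qed.

(** Chosen so that the eigenvalue equation for [mu ^+ 2] reads [f'' = - nu ^+ 2 f] on every edge,
    whatever its sign. *)
Definition edge_freq mu j : R[i] := if (j < np)%N then mu else 'i%C * mu.
Local Notation nu := edge_freq.

Lemma edge_freq_sqr mu j : eps j * nu mu j ^+ 2 = mu ^+ 2.
Proof.
rewrite /eps /nu; case: ifP => _; first by rewrite mul1r.
by rewrite exprMn [_ ^+ 2 as X in X * _]expr2 iCiC !mulN1r opprK.
Qed.

Lemma edge_freq_neq0 mu j : mu != 0 -> nu mu j != 0.
Proof. by rewrite /nu; case: ifP => _ // m0; rewrite mulf_neq0// iC_neq0. Qed.

Lemma csin_edge_freq_neq0 mu j : A_injective (mu ^+ 2) -> mu != 0 ->
  csin (nu mu j) != 0.
Proof.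
move=> inj mu0; apply/eqP => s0.
have [s [Hs d2 [b0 b1] db _]] := sine_edge (nu mu j).
have [t0 w0 zb] := @zero_edge R.
have t1 : bvalue (0 : L2 R) 0 = 0 by rewrite zb// lexx ler01.
have t2 : bvalue (0 : L2 R) 1 = 0 by rewrite zb// lexx ler01.
have b0' : bvalue s 0 = 0 by rewrite b0 s0 oppr0.
pose f : L2G := [ffun k => if k == j then s else 0].
have fb k x : bvalue (f k) x = if k == j then bvalue s x else bvalue (0 : L2 R) x.
  by rewrite ffunE; case: ifP.
have df : domT f.
  split => [k|k|k l].
  - by rewrite ffunE; case: ifP.
  - by rewrite fb; case: ifP.
  - by rewrite !fb b0' t1 !if_same.
have f0 : G0 f = 0 by rewrite (Gamma0E edge0 df) fb b0' t1 if_same.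
have Tf : T f = mu ^+ 2 *: f.
  apply/ffunP => k; rewrite opTE [RHS]ffunE ffunE; case: ifP => [/eqP->|_].
    by rewrite d2 scalerA mulrNN edge_freq_sqr.
  by rewrite !w0 !scaler0.
have fz := inj f df f0 Tf.
have sz : s = 0 by move/ffunP: fz => /(_ j); rewrite !ffunE eqxx.
(* The zero function has slope 0 at the centre, but the sine has slope [nu * ccos nu], where neither
   factor vanishes. *)
move: db; rewrite sz !w0 t1 => /esym/eqP; rewrite mulf_eq0.
by rewrite (negbTE (edge_freq_neq0 j mu0)) (negbTE (csin_ccos_neq0 s0)).
Qed.

(** At [mu = 0] the second expression would be 0 because of the factor [mu], whereas its limit is
    [- N%:R]. *)
Definition weyl_value mu : R[i] :=
  if mu ^+ 2 == 0 then - N%:R else - (mu * (np%:R * ccot mu + nm%:R * ccoth mu)).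

(** The identity [i cot(i mu) = coth mu], which converts the slopes on the negative edges. *)
Lemma ccot_edge_freq mu : csin ('i%C * mu) != 0 ->
  'i%C * mu * ccos ('i%C * mu) / csin ('i%C * mu) = mu * ccoth mu.
Proof.
rewrite /ccoth /ccosh /csinh /csin /ccos mulrA iCiC mulN1r opprK => s0.
have i0 := @iC_neq0 R; have n2 : (2 : R[i]) != 0 by rewrite pnatr_eq0.
move: s0; rewrite mulf_eq0 invr_eq0 mulf_eq0 (negbTE n2) (negbTE i0) !orbF => s0.
have s1 : cexp mu - cexp (- mu) != 0 by rewrite -opprB oppr_eq0.
move: (cexp mu) (cexp (- mu)) s0 s1 => X Y s0 s1.
(* The square of the imaginary unit is kept as a visible factor, since [field] cannot evaluate
   it. *)
transitivity (- ('i%C * 'i%C) * (mu * ((X + Y) / (X - Y)))).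
  by field; rewrite ?s0 ?s1 ?n2 ?i0.
by rewrite iCiC; field; rewrite ?s1 ?n2.
Qed.

(** Dividing each edge sine by [- csin nu] gives the common value 1 at the centre; the slopes there
    then sum to the Weyl function. This [u] is the value of the gamma field at 1. *)
Lemma gamma_solution mu : A_injective (mu ^+ 2) -> exists u : L2G,
  [/\ domT u, T u = mu ^+ 2 *: u, G0 u = 1, G1 u = weyl_value mu &
   forall j, (u j : R -> R[i]) = (fun x => if mu ^+ 2 == 0 then 1 - x%:C
       else - (csin (nu mu j * x%:C - nu mu j) / csin (nu mu j)))
     %[ae @lebesgue_measure R in unit_itv]].
Proof.
move=> inj; rewrite /weyl_value; have [m0|] := eqVneq (mu ^+ 2) 0.
  have [f [df tf f0 f1 fe]] := affine_star; exists f; split => //.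
  by rewrite tf m0 scale0r.
rewrite sqrf_eq0 => m0.
have s0 j := csin_edge_freq_neq0 j inj m0.
have /choice[s hs] : forall j, exists s : L2 R, [/\ H2 s,
    wderiv (wderiv s) = - nu mu j ^+ 2 *: s,
    bvalue s 0 = - csin (nu mu j) /\ bvalue s 1 = 0,
    bvalue (wderiv s) 0 = nu mu j * ccos (nu mu j) &
    (s : R -> R[i]) = (fun x => csin (nu mu j * x%:C - nu mu j))
      %[ae @lebesgue_measure R in unit_itv]].
  by move=> j; exact: sine_edge.
have [z0 w0 zb] := @zero_edge R.
have b0 : 0 <= (0 : R) <= 1 by rewrite lexx ler01.
have b1 : 0 <= (1 : R) <= 1 by rewrite lexx ler01.
pose k j := - (csin (nu mu j))^-1.
(* The summand 0 gives the scaled sine the shape required by [H2_lin]. *)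
pose u : L2G := [ffun j => k j *: s j + 0].
have l j : [/\ H2 (u j), wderiv (wderiv (u j)) = - nu mu j ^+ 2 *: u j,
    bvalue (u j) 0 = 1 /\ bvalue (u j) 1 = 0 &
    bvalue (wderiv (u j)) 0 = - (nu mu j * ccos (nu mu j) / csin (nu mu j))].
  have [sH s2 [sb0 sb1] sd _] := hs j.
  have [h e1 e2 e3 e4] := H2_lin (k j) sH z0; rewrite ffunE; split => //.
  - by rewrite e2 s2 !w0 !addr0 !scalerA mulrC.
  - rewrite (e3 0 b0) (e3 1 b1) sb0 sb1 !zb// mulr0 !addr0; split => //.
    by rewrite /k mulrNN mulVf.
  - by rewrite (e4 0 b0) sd w0 zb// addr0 /k mulNr mulrC.
have du : domT u.
  split => [j|j|i j].
  - by case: (l j).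
  - by case: (l j) => _ _ [].
  - by case: (l i) => _ _ [-> _] _; case: (l j) => _ _ [-> _] _.
exists u; split => //.
- apply/ffunP => j; rewrite opTE; case: (l j) => _ -> _ _.
  by rewrite scalerA mulrNN edge_freq_sqr [RHS]ffunE.
- by rewrite (Gamma0E edge0 du); case: (l edge0) => _ _ [].
- transitivity (\sum_j - (nu mu j * ccos (nu mu j) / csin (nu mu j))).
    by apply: eq_bigr => j _; case: (l j).
  rewrite sumrN; congr (- _).
  rewrite (eq_bigr (fun j : 'I_N => if (j < np)%N then mu * ccot mu else mu * ccoth mu)).
    rewrite big_split_ord /=.
    rewrite (eq_bigr (fun=> mu * ccot mu)); last by move=> i _; rewrite ltn_ord.
    rewrite [X in _ + X](eq_bigr (fun=> mu * ccoth mu)).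
      by rewrite !sumr_const !card_ord mulrDr !(mulrCA mu) !mulr_natl.
    by move=> i _; rewrite ltnNge leq_addr.
  move=> j _; have := s0 j; rewrite /nu; case: ifP => _ sj; first by rewrite -mulrA.
  exact: ccot_edge_freq.
- move=> j; have [_ _ _ _ se] := hs j.
  have e := L2_linE (k j) (s j) 0; have z := @L2_zeroE R.
  rewrite ffunE; apply: (ae_and4 _ e se z z) => x e1 e2 e3 _ xI.
  by rewrite e1// e2// e3// addr0 /k mulNr mulrC.
Qed.

(** * The kernel of [T - lam], the gamma field and the Weyl function *)

Section kernel.
Variables (lam : R[i]) (u : L2G).
Hypotheses (inj : A_injective lam) (du : domT u) (Tu : T u = lam *: u)
  (u0 : G0 u = 1).
Local Notation ker := (opker (shiftop (@opT R np nm) lam)).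

Lemma kernelE f : ker f <-> domT f /\ T f = lam *: f.
Proof.
split=> [[df /=]|[df Tf]].
  by move=> e; split => //; apply/eqP; rewrite -subr_eq0 -shiftTE; apply/eqP.
by split => //; rewrite shiftTE Tf subrr.
Qed.

Lemma kernelZ c : ker (c *: u).
Proof.
apply/kernelE; have [d t _ _] := domTZ c du; split => //.
by rewrite t Tu !scalerA mulrC.
Qed.

(** The difference of two kernel elements with equal [Gamma0] lies in the domain of [A], where [inj]
    makes it zero. *)
Lemma kernel_inj : {in ker &, injective G0}.
Proof.
move=> f g; rewrite !inE => /kernelE[df Tf] /kernelE[dg Tg] e.
have [d t g0 _] := domT_sub df dg.
apply/eqP; rewrite -subr_eq0; apply/eqP; apply: inj => //.
  by rewrite g0 e subrr.
by rewrite t Tf Tg -scalerBr.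
Qed.

Lemma Gamma0Zu c : G0 (c *: u) = c.
Proof. by have [_ _ -> _] := domTZ c du; rewrite u0 mulr1. Qed.

Lemma Gamma0_bij : set_bij ker setT G0.
Proof.
split=> //; first exact: kernel_inj.
by move=> c _; exists (c *: u); [exact: kernelZ|exact: Gamma0Zu].
Qed.

Lemma gamma_fieldE c : gamma_field np nm lam c = c *: u.
Proof.
rewrite /gamma_field -[in LHS](Gamma0Zu c).
by apply: (pinvKV _ kernel_inj); rewrite inE; exact: kernelZ.
Qed.

Lemma kernel_span f : ker f -> f = G0 f *: u.
Proof.
move=> kf; apply: kernel_inj; rewrite ?inE//; first exact: kernelZ.
by rewrite Gamma0Zu.
Qed.

(** The set inspected by [xget] is a singleton: testing at [u] determines [m], and [kernel_span]
    shows that this [m] works on the whole kernel. *)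
Lemma weylE : weyl np nm lam = G1 u.
Proof.
rewrite /weyl; case: xgetP => [m _ /(_ u)|/(_ (G1 u))] /=.
  by rewrite u0 mulr1 => -> //; rewrite -[u]scale1r; exact: kernelZ.
case=> f kf; rewrite {2}(kernel_span kf).
by have [_ _ _ ->] := domTZ (G0 f) du; rewrite mulrC.
Qed.

(** Green's identity against [u] leaves only [Gamma1 f], because [Gamma0 f = 0] and [Gamma0 u = 1].
    Used at the conjugate parameter, it gives the adjoint in Krein's formula with [f] the resolvent
    of [A] applied to [g]. *)
Lemma gamma_adjE f g : domT f -> G0 f = 0 -> T f - lam^*%C *: f = g ->
  gamma_adj lam g = G1 f.
Proof.
move=> df f0 fg.
have E c : krein g (gamma_field np nm lam c) = G1 f * c^*%C.
  rewrite gamma_fieldE kreinZr mulrC; congr (_ * _).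
  have := green df du; rewrite f0 u0 mul0r subr0 Tu kreinZr.
  rewrite conjc1 mulr1.
  by move=> <-; rewrite -fg addrC -scaleNr krein_linl mulNr addrC.
rewrite /gamma_adj; case: xgetP => [d _ H|H].
  by have := H 1; rewrite E conjc1 !mulr1.
by case: (H (G1 f)) => c; rewrite E.
Qed.

End kernel.

(** * Resolvents and Krein's formula *)

Lemma resolventE (D : set L2G) lam g (C := restriction (@opT R np nm) D) :
  set_bij (opdom C) setT (shiftop C lam) ->
  [/\ domT (resolvent C lam g), D (resolvent C lam g) &
      T (resolvent C lam g) - lam *: resolvent C lam g = g].
Proof.
move=> bij; have [_ _ surj] := bij.
have [+ _ _] := bijpinv_bij (fun=> 0) bij; move=> /(_ g Logic.I) [d1 d2].
split => //; rewrite -(@shiftTE lam (resolvent C lam g)).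
by apply: (surjpK _ surj); rewrite inE.
Qed.

Lemma krein_formula lam : rhoA np nm lam -> rhoB np nm lam ->
  weyl np nm lam != 0 /\ forall g, resolvent A lam g = resolvent B lam g +
    gamma_field np nm lam ((weyl np nm lam)^-1 * gamma_adj (lam^*%C) g).
Proof.
move=> hA hB; have injA := resolvent_A_injective hA.
have injA' := symmetric_A_injective hA.
(* [gamma_solution] takes a square root of the spectral parameter; any root will do here, so [sqrtc]
   is used. *)
have [u [du Tu u0 _ _]] : exists u : L2G, [/\ domT u, T u = lam *: u, G0 u = 1,
    True & True].
  have := @gamma_solution (sqrtc lam); rewrite sqr_sqrtc => /(_ injA)[u [? ? ? _ _]].
  by exists u.
have [v [dv Tv v0 _ _]] : exists u : L2G, [/\ domT u, T u = lam^*%C *: u, G0 u = 1,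
    True & True].
  have := @gamma_solution (sqrtc lam^*%C); rewrite sqr_sqrtc => /(_ injA')[v [? ? ? _ _]].
  by exists v.
have W := weylE injA du Tu u0.
have W0 : weyl np nm lam != 0.
  (* Were [Gamma1 u] zero, [u] would be a nonzero element of the kernel of [B - lam]. *)
  rewrite W; apply/eqP => u1; have [[_ inj _] _] := hB.
  have [t0 g0 g1] := domT0E.
  have uz : u = 0.
    have dBu : opdom B u by exact: (conj du u1).
    have dB0 : opdom B 0 by split; [exact: domT0|].
    apply: (inj u 0 (mem_set dBu) (mem_set dB0)).
    by rewrite !shiftBE t0 Tu scaler0 !subrr.
  by move: u0; rewrite uz g0 => /eqP; rewrite eq_sym oner_eq0.
split => // g.
have [dfA fA0 fAg] := resolventE g hA.1; have [dfB fB0 fBg] := resolventE g hB.1.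
rewrite -/A -/B in dfA fA0 fAg dfB fB0 fBg.
move: (resolvent A lam g) (resolvent B lam g) dfA fA0 fAg dfB fB0 fBg => f f'.
move=> df f0 fg df' f1' fg'.
have E : gamma_adj (lam^*%C) g = G1 f.
  apply: (gamma_adjE injA' dv Tv v0 df f0).
  by rewrite conjcK.
rewrite E (gamma_fieldE injA du Tu u0) W.
have [d t _ g1] := domT_sub df df'.
have kf : opker (shiftop (@opT R np nm) lam) (f - f').
  apply/kernelE; split => //; rewrite t; apply/eqP; rewrite -subr_eq0 scalerBr.
  have sACA (V : zmodType) (x y z w : V) : x - y - (z - w) = (x - z) - (y - w).
    by rewrite !opprB addrACA [RHS]addrACA; congr (_ + _); exact: addrC.
  by rewrite sACA fg fg' subrr.
have := kernel_span injA du Tu u0 kf.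
(* Since [f - f'] is [Gamma0 (f - f')] times [u] and [Gamma1 f' = 0], applying [Gamma1] determines
   this coefficient. *)
have -> : G0 (f - f') = (G1 u)^-1 * G1 f.
  rewrite W in W0; have [_ _ _ e1] := domTZ (G0 (f - f')) du.
  move: g1; rewrite {1}(kernel_span injA du Tu u0 kf) e1 f1' subr0 => <-.
  by rewrite mulrCA mulVf// mulr1.
by move=> <-; rewrite addrC subrK.
Qed.

End star_graph_operators.

(* The sign in Krein's formula is the one that goes with ker Gamma0 = dom A and
   Gamma1 f = weyl * Gamma0 f: for g in L^2(G), gamma_adj(conj lam) g is
   Gamma1 ((A - lam)^-1 g).  At lam = 0 the expression for gamma is the limit of
   the one for lam <> 0. *)
Theorem proposition3p3 (R : realType) (np nm : nat)
    (np_gt0 : (0 < np)%N) (nm_gt0 : (0 < nm)%N) :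
  [/\ selfadjoint (@krein R np nm) (@opB R np nm),
      forall lam : R[i], rhoA np nm lam -> rhoB np nm lam ->
        weyl np nm lam != 0 /\
        forall g : {ffun 'I_(np + nm) -> L2 R},
          resolvent (@opA R np nm) lam g =
          resolvent (@opB R np nm) lam g +
          gamma_field np nm lam
            ((weyl np nm lam)^-1 * gamma_adj (lam^*%C) g) &
      forall lam : R[i], rhoA np nm lam ->
        set_bij (opker (shiftop (@opT R np nm) lam)) setT (@Gamma0 R np nm) /\
        forall mu : R[i], mu ^+ 2 = lam ->
          (forall (c : R[i]) (j : 'I_(np + nm)),
            let nu := if (j < np)%N then mu else 'i%C * mu in
            (gamma_field np nm lam c j : R -> R[i]) =
              (fun x : R => if lam == 0 then c * (1 - x%:C)
                else - (c * csin (nu * x%:C - nu) / csin nu))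
              %[ae @lebesgue_measure R in unit_itv]) /\
          weyl np nm lam =
            if lam == 0 then - (np + nm)%:R
            else - (mu * (np%:R * ccot mu + nm%:R * ccoth mu))].
Proof.
split; first exact: opB_selfadjoint.
  exact: krein_formula.
move=> lam hA; have inj := resolvent_A_injective np_gt0 hA; split.
  have := @gamma_solution _ _ nm np_gt0 (sqrtc lam).
  rewrite sqr_sqrtc => /(_ inj)[u [du Tu u0 _ _]].
  exact: Gamma0_bij inj du Tu u0.
(* Here [mu] is an arbitrary square root of [lam], so the explicit solution is taken at [mu]
   itself. *)
move=> mu mulam; rewrite -mulam in inj *.
have [u [du Tu u0 u1 ue]] := gamma_solution np_gt0 inj.
split; last by rewrite (weylE np_gt0 inj du Tu u0) u1.
move=> c j nu; rewrite (gamma_fieldE np_gt0 inj du Tu u0) ffunE.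
have h1 := L2_scaleE c (u j); have h2 := ue j.
apply: (ae_transfer2 _ h1 h2) => x e1 e2 xI; rewrite e1// e2//.
by case: ifP => _ //; rewrite mulrN mulrA.
Qed.
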